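(* Let $\mathcal{R}$ be a von Neumann algebra acting on a separable Hilbert space with a faithful normal tracial state $\tau$. Then $\mathcal{R}$ can be tracially embedded into a maximal tracial ultraproduct of finite-dimensional algebras; that is, there exist an infinite set $I$, a nontrivial ultrafilter $\alpha$ on $I$, finite-dimensional unital C*-algebras $\mathcal{A}_i$ with states $\varphi_i$ $(i\in I)$, a maximal $\varphi_\alpha$-tracial C*-algebra $\mathcal{M}\subset\prod_{i\in I}\mathcal{A}_i$, and a unital $*$-homomorphism $\pi:\mathcal{R}\to\prod_{\mathcal{M}}^{\alpha}(\mathcal{A}_i,\varphi_i)$ such that $\tau=\hat{\varphi}_\alpha\circ\pi$.
   Context: Let $\{\mathcal{A}_i:i\in I\}$ be an infinite collection of unital C*-algebras, $\varphi_i$ a state on $\mathcal{A}_i$ for each $i$, and $\alpha$ a nontrivial (free) ultrafilter on $I$. Let $\mathcal{A}=\prod_{i\in I}\mathcal{A}_i$ be the C*-direct product (bounded families), and define a state $\varphi_\alpha$ on $\mathcal{A}$ by $\varphi_\alpha(\{a_i\})=\lim_{i\to\alpha}\varphi_i(a_i)$. A C*-subalgebra $\mathcal{M}\subset\mathcal{A}$ is $\varphi_\alpha$-tracial if $\varphi_\alpha(ab)=\varphi_\alpha(ba)$ for all $a,b\in\mathcal{M}$; it is a maximal $\varphi_\alpha$-tracial C*-algebra if it is $\varphi_\alpha$-tracial and is not properly contained in another $\varphi_\alpha$-tracial C*-subalgebra of $\mathcal{A}$. For such $\mathcal{M}$, the maximal tracial ultraproduct with respect to $\mathcal{M}$ is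 $$\prod_{\mathcal{M}}^{\alpha}(\mathcal{A}_i,\varphi_i)=\mathcal{M}/\mathcal{J}_\alpha(\mathcal{M}),\qquad \mathcal{J}_\alpha(\mathcal{M})=\{a\in\mathcal{M}:\varphi_\alpha(a^{*}a)=0\},$$ where $\mathcal{J}_\alpha(\mathcal{M})$ is a closed two-sided ideal of $\mathcal{M}$. Since $\varphi_\alpha|_{\mathcal{M}}$ is tracial, it induces a tracial state $\hat{\varphi}_\alpha$ on the quotient. *)

(* Defs.v *)
From HB Require Import structures.
From mathcomp Require Import generic_quotient.
From mathcomp Require Import all_boot all_order all_algebra.
From mathcomp Require Import complex.
From mathcomp Require Import boolp classical_sets functions cardinality.
From mathcomp Require Import reals topology normedtype sequences.
From mathcomp Require Import ring lra.
Set Implicit Arguments.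
Unset Strict Implicit.
Unset Printing Implicit Defensive.
Import Order.TTheory GRing.Theory Num.Theory.
Import numFieldNormedType.Exports.
Local Open Scope classical_set_scope.
Local Open Scope ring_scope.
Local Open Scope quotient_scope.
Local Open Scope complex_scope.
Notation cmod := ComplexField.Normc.normc.

HB.mixin Record Algebra_hasStar (R : realType) A & GRing.Algebra R[i] A := {
  star : A -> A;
  starK : involutive star;
  starD : {morph star : x y / x + y};
  starZ : forall (c : R[i]) x, star (c *: x) = conjc c *: star x;
  starM : forall x y, star (x * y) = star y * star x
}.

#[short(type="starAlgType")]
HB.structure Definition StarAlgebra (R : realType) :=
  {A of GRing.Algebra R[i] A & Algebra_hasStar R A}.

(* The norm is a field of its own, with values in R: MathComp has no structure
   joining rings and normed modules below numDomainType, so a ring cannot also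
   be declared a normedModType. *)
HB.mixin Record StarAlgebra_isCStar (R : realType) A & StarAlgebra R A := {
  cnorm : A -> R;
  cnormD : forall x y, cnorm (x + y) <= cnorm x + cnorm y;
  cnormZ : forall (c : R[i]) x, cnorm (c *: x) = cmod c * cnorm x;
  cnorm0_eq0 : forall x, cnorm x = 0 -> x = 0;
  cnormM : forall x y, cnorm (x * y) <= cnorm x * cnorm y;
  cnorm_star : forall x, cnorm (star x * x) = cnorm x ^+ 2;
  cnorm_complete : forall u : nat -> A,
    (forall e, 0 < e -> exists N, forall m n, (N <= m)%N -> (N <= n)%N ->
       cnorm (u m - u n) < e) ->
    exists l, forall e, 0 < e ->
      exists N, forall n, (N <= n)%N -> cnorm (u n - l) < e
}.

#[short(type="cstarType")]
HB.structure Definition CStarAlgebra (R : realType) :=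
  {A of StarAlgebra R A & StarAlgebra_isCStar R A}.

Section StarTheory.
Variables (R : realType) (A : starAlgType R).
Implicit Types a b : A.

Lemma star0 : star (0 : A) = 0.
Proof. by apply: (addrI (star 0)); rewrite -starD !addr0. Qed.

Lemma starN a : star (- a) = - star a.
Proof. by apply: (addrI (star a)); rewrite -starD !subrr star0. Qed.

Lemma starB a b : star (a - b) = star a - star b.
Proof. by rewrite starD starN. Qed.

Lemma star1 : star (1 : A) = 1.
Proof. by rewrite -[LHS]mulr1 -{2}(starK 1) -starM mulr1 starK. Qed.

End StarTheory.

Record state (R : realType) (A : starAlgType R) := State {
  state_fun :> {scalar A};
  state_ge0 : forall a, 0 <= state_fun (star a * a);
  state1 : state_fun 1 = 1
}.

Lemma conj_pos (R : realType) (t : R[i]) : 0 <= t -> conjc t = t.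
Proof. by case: t => x y /ger0_Im /= ->; rewrite oppr0. Qed.

Lemma mulcJE (R : realType) (z : R[i]) : z * conjc z = (cmod z ^+ 2)%:C.
Proof.
case: z => x y; rewrite /= sqr_sqrtr ?addr_ge0 ?sqr_ge0//.
by apply/eqP; rewrite eq_complex /=; apply/andP; split; apply/eqP; ring.
Qed.

Section StateTheory.
Variables (R : realType) (A : starAlgType R) (phi : state A).
Implicit Types a b : A.

Lemma state_expand (c : R[i]) a b :
  phi (star (a + c *: b) * (a + c *: b)) =
  phi (star a * a) + c * phi (star a * b) + conjc c * phi (star b * a)
  + conjc c * c * phi (star b * b).
Proof.
rewrite starD starZ mulrDl !mulrDr -!(@scalerAl _ A) -!(@scalerAr _ A).
by rewrite !linearD !linearZ /=; ring.
Qed.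

Lemma state_conj a b : phi (star b * a) = conjc (phi (star a * b)).
Proof.
have p0 := ger0_Im (state_ge0 phi a); have q0 := ger0_Im (state_ge0 phi b).
have /ger0_Im := state_ge0 phi (a + 'i%C *: b).
have /ger0_Im := state_ge0 phi (a + 1 *: b).
rewrite !state_expand; move: p0 q0; case: (phi (star a * a)) (phi (star b * b)) => p p' [q q'].
move: (phi (star a * b)) (phi (star b * a)) => [s s'] [t t'] /= -> -> {p' q'}.
simpc => /= h1 h2.
apply/eqP; rewrite eq_complex /=; apply/andP; split; apply/eqP. lra. lra.
Qed.

Lemma state_star a : phi (star a) = conjc (phi a).
Proof. by have := state_conj 1 a; rewrite mulr1 star1 mul1r. Qed.

Lemma state_CS a b : (cmod (phi (star a * b)) ^+ 2)%:C <=
  phi (star a * a) * phi (star b * b).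
Proof.
rewrite -mulcJE state_conj conjcK mulrC.
set x := phi (star b * a).
have xE : phi (star a * b) = conjc x by rewrite state_conj.
have N0 : 0 <= x * conjc x by rewrite mulcJE ler0c sqr_ge0.
have := state_ge0 phi a; have := state_ge0 phi b.
set q := phi (star b * b); set p := phi (star a * a) => q0 p0.
have E (t : R[i]) : 0 <= t ->
    0 <= p - t * (x * conjc x) *+ 2 + t ^+ 2 * (x * conjc x) * q.
  move=> t0; have := state_ge0 phi (a + (- (t * x)) *: b).
  rewrite state_expand xE rmorphN rmorphM /= (conj_pos t0) -/x -/p -/q.
  by congr (_ <= _); ring.
move: q0; rewrite le_eqVlt => /orP[/eqP q0|q0].
  rewrite -q0 mulr0; move: E; rewrite -q0.
  have [->|N0'] := eqVneq (x * conjc x) 0; first by [].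
  have Np : 0 < x * conjc x by rewrite lt_def N0' N0.
  have t0 : 0 <= (p + 1) / (x * conjc x) by rewrite divr_ge0 ?addr_ge0.
  move=> /(_ _ t0); rewrite divfK// mulr0 addr0.
  have -> : p - (p + 1) *+ 2 = - (p + 2%:R) by ring.
  have p2 : 0 < p + 2%:R by rewrite ltr_wpDl.
  by rewrite oppr_ge0 => /(lt_le_trans p2); rewrite ltxx.
have := E q^-1; rewrite invr_ge0 ltW// => /(_ isT).
have -> : p - q^-1 * (x * conjc x) *+ 2 + q^-1 ^+ 2 * (x * conjc x) * q =
   p - (x * conjc x) / q by field; rewrite gt_eqF.
by rewrite subr_ge0 ler_pdivrMr.
Qed.

Lemma state_null a b : phi (star a * a) = 0 -> phi (star a * b) = 0.
Proof.
move=> a0; have := state_CS a b; rewrite a0 mul0r lecR => le0; apply: ComplexField.Normc.eq0_normc.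
by apply/eqP; rewrite -sqrf_eq0 eq_le le0 sqr_ge0.
Qed.
End StateTheory.

Section CStarTheory.
Variables (R : realType) (A : cstarType R).
Implicit Types x y : A.

Lemma cmod_ge0 (z : R[i]) : 0 <= cmod z.
Proof. by case: z => a b; rewrite /= sqrtr_ge0. Qed.

Lemma cnorm0 : cnorm (0 : A) = 0.
Proof. by rewrite -(scale0r 0) cnormZ ComplexField.Normc.normc0 mul0r. Qed.

Lemma cmodN1 : cmod (-1 : R[i]) = 1.
Proof. by rewrite /= oppr0 expr0n addr0 sqrrN expr1n sqrtr1. Qed.

Lemma cnormN x : cnorm (- x) = cnorm x.
Proof. by rewrite -scaleN1r cnormZ cmodN1 mul1r. Qed.

Lemma cnormB x y : cnorm (x - y) = cnorm (y - x).
Proof. by rewrite -cnormN opprB. Qed.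

Lemma cnorm_ge0 x : 0 <= cnorm x.
Proof.
have := cnormD x (- x); rewrite subrr cnorm0 cnormN.
by rewrite -mulr2n pmulrn_lge0.
Qed.

Lemma cnorm_eq0 x : (forall e : R, 0 < e -> cnorm x <= e) -> x = 0.
Proof.
move=> xe; apply: cnorm0_eq0; apply/eqP; rewrite eq_le cnorm_ge0 andbT.
by apply/ler_addgt0Pr => e e0; rewrite add0r xe.
Qed.

Lemma cnorm_starE x : cnorm (star x) = cnorm x.
Proof.
suff H y : cnorm y <= cnorm (star y).
  by apply/eqP; rewrite eq_le H andbT -{2}(starK x) H.
have [->|y0] := eqVneq (cnorm y) 0; first exact: cnorm_ge0.
rewrite -(@ler_pM2r _ (cnorm y)); first by rewrite -expr2 -cnorm_star cnormM.
by rewrite lt_def y0 cnorm_ge0.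
Qed.

Lemma half_cmod : cmod ((2%:R^-1 : R)%:C) = 2%:R^-1.
Proof. by rewrite /= expr0n addr0 sqrtr_sqr ger0_norm// invr_ge0. Qed.

Lemma expr_small (r e : R) : 0 <= r < 1 -> 0 < e -> exists n, r ^+ n < e.
Proof.
move=> /andP[r0 r1] e0.
have /cvgrPdist_lt /(_ _ e0) [N _ /(_ N (leqnn N))] :=
  @cvg_expr R r ltac:(by rewrite ger0_norm).
by rewrite sub0r normrN ger0_norm ?exprn_ge0//; exists N.
Qed.

(* y is the limit of y |-> (x + y ^+ 2) / 2 iterated from 0. *)
Lemma cstar_sqrt x : star x = x -> cnorm x < 1 ->
  exists2 y, star y = y & (1 - y) * (1 - y) = 1 - x.
Proof.
move=> xx; set r := cnorm x => r1; have r0 : 0 <= r by exact: cnorm_ge0.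
pose h : R[i] := (2%:R^-1 : R)%:C.
pose F y := h *: (x + y * y); pose u n := iter n F 0.
have uS n : u n.+1 = F (u n) by [].
have ur n : cnorm (u n) <= r.
  elim: n => [|n IH]; first by rewrite /u /= cnorm0.
  rewrite uS /F cnormZ half_cmod ler_pdivrMl//.
  apply: (le_trans (cnormD _ _)); rewrite mulr_natl mulr2n lerD2l.
  apply: (le_trans (cnormM _ _)); apply: (@le_trans _ _ (cnorm (u n) * 1)).
    by apply: ler_wpM2l; [exact: cnorm_ge0|exact: le_trans IH (ltW r1)].
  by rewrite mulr1.
have FB y z : cnorm (F y - F z) <=
    2%:R^-1 * ((cnorm y + cnorm z) * cnorm (y - z)).
  rewrite /F -scalerBr cnormZ half_cmod; apply: ler_wpM2l; first by rewrite invr_ge0.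
  have -> : x + y * y - (x + z * z) = y * (y - z) + (y - z) * z.
    by rewrite opprD addrACA subrr add0r mulrBr mulrBl addrA subrK.
  apply: (le_trans (cnormD _ _)); rewrite [leRHS]mulrDl; apply: lerD.
    exact: cnormM.
  by rewrite mulrC; apply: (le_trans (cnormM _ _)); rewrite mulrC.
have u1 n : cnorm (u n.+1 - u n) <= r ^+ n.
  elim: n => [|n IH]; first by rewrite subr0 expr0 (le_trans (ur _))// ltW.
  rewrite [in u n.+2]uS [in X in _ - X]uS exprS.
  apply: (le_trans (FB _ _)); rewrite mulrA; apply: ler_pM => //.
  - by rewrite mulr_ge0 ?invr_ge0 ?addr_ge0 ?cnorm_ge0.
  - exact: cnorm_ge0.
  - by rewrite ler_pdivrMl// mulr_natl mulr2n; apply: lerD; exact: ur.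
have uk n k : (1 - r) * cnorm (u (n + k)%N - u n) <= r ^+ n - r ^+ (n + k).
  elim: k => [|k IH]; first by rewrite addn0 subrr cnorm0 mulr0 subrr.
  have -> : u (n + k.+1)%N - u n =
     (u (n + k).+1 - u (n + k)%N) + (u (n + k)%N - u n).
    by rewrite addnS addrA subrK.
  apply: (@le_trans _ _ ((1 - r) * (r ^+ (n + k) + cnorm (u (n + k)%N - u n)))).
    apply: ler_wpM2l; first by rewrite subr_ge0 ltW.
    by apply: (le_trans (cnormD _ _)); rewrite lerD2r.
  rewrite mulrDr; apply: (le_trans (lerD (lexx _) IH)).
  by rewrite addnS exprS le_eqVlt; apply/orP; left; apply/eqP; ring.
have sr0 : 0 < 1 - r by rewrite subr_gt0.
have [e e0|l lP] := cnorm_complete u.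
  have [N NP] := expr_small (introT andP (conj r0 r1))
    (mulr_gt0 sr0 (divr_gt0 e0 (ltr0Sn R 1))).
  have H m : (N <= m)%N -> cnorm (u m - u N) < e / 2%:R.
    move=> Nm; rewrite -(ltr_pM2l sr0); apply: le_lt_trans NP.
    have := uk N (m - N)%N; rewrite subnKC// => /le_trans; apply.
    by rewrite gerBl exprn_ge0.
  exists N => m n Nm Nn.
  have -> : u m - u n = (u m - u N) + (u N - u n) by rewrite addrA subrK.
  apply: (le_lt_trans (cnormD _ _)); rewrite (splitr e).
  by apply: ltrD; [|rewrite cnormB]; exact: H.
have lF : l = F l.
  apply/eqP; rewrite -subr_eq0; apply/eqP; apply: cnorm_eq0 => e e0.
  pose K := 1 + 2%:R^-1 * (r + cnorm l).
  have K0 : 0 < K by rewrite ltr_wpDr ?mulr_ge0 ?invr_ge0 ?addr_ge0 ?cnorm_ge0.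
  have [N NP] := lP _ (divr_gt0 e0 K0).
  have -> : l - F l = (l - u N.+1) + (F (u N) - F l).
    by rewrite uS addrA subrK.
  apply: (le_trans (cnormD _ _)).
  apply: (@le_trans _ _ (e / K + 2%:R^-1 * (r + cnorm l) * (e / K))).
    apply: lerD; first by rewrite cnormB ltW// NP.
    apply: (le_trans (FB _ _)); rewrite mulrA; apply: ler_pM.
    - by rewrite mulr_ge0 ?invr_ge0 ?addr_ge0 ?cnorm_ge0.
    - exact: cnorm_ge0.
    - by apply: ler_wpM2l; rewrite ?invr_ge0 ?lerD2r.
    - by rewrite ltW// NP.
  by rewrite -[X in X + _]mul1r -mulrDl mulrCA divff ?mulr1// gt_eqF.
have us n : star (u n) = u n.
  elim: n => [|n IH]; first by rewrite /u /= star0.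
  by rewrite uS /F starZ starD starM IH xx conjc_real.
exists l.
  apply/eqP; rewrite -subr_eq0; apply/eqP; apply: cnorm_eq0 => e e0.
  have [N NP] := lP _ (divr_gt0 e0 (ltr0Sn R 1)).
  have -> : star l - l = (star (l - u N)) + (u N - l).
    by rewrite starB us addrA subrK.
  apply: (le_trans (cnormD _ _)); rewrite (splitr e) cnorm_starE cnormB.
  by apply: lerD; rewrite ltW// NP.
have l2 : l + l = x + l * l.
  rewrite -[RHS]scale1r.
  have -> : 1 = h + h.
    by rewrite /h -rmorphD /= -mulr2n -[_ *+ 2]mulr_natl divff ?rmorph1 ?pnatr_eq0.
  by rewrite scalerDl -/(F l) -lF.
have -> : x = l + l - l * l by rewrite l2 addrK.
rewrite mulrBr mulr1 mulrBl mul1r !opprB -addrA; congr (1 + _).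
by rewrite addrCA opprD.
Qed.

Lemma state_bound (phi : state A) x : cmod (phi x) <= cnorm x.
Proof.
have H1 y : star y = y -> cnorm y < 1 -> phi y <= 1.
  move=> yy y1; have [z zz E] := cstar_sqrt yy y1.
  have := state_ge0 phi (1 - z).
  by rewrite starB star1 zz E linearB /= state1 subr_ge0.
have [P P0 PE] : exists2 P : R, 0 <= P & phi (star x * x) = P%:C.
  have := state_ge0 phi x; case: (phi _) => a b h; exists a.
    by move: h; rewrite lecE /= => /andP[].
  by have /= -> := ger0_Im h.
have PN : P <= cnorm x ^+ 2.
  apply/ler_addgt0Pr => e e0; set s := cnorm x ^+ 2 + e.
  have s0 : 0 < s by rewrite ltr_wpDl ?sqr_ge0.
  have sV : cmod (s^-1)%:C = s^-1.
    by rewrite /= expr0n addr0 sqrtr_sqr ger0_norm// invr_ge0 ltW.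
  have /H1 : star ((s^-1)%:C *: (star x * x)) = (s^-1)%:C *: (star x * x).
    by rewrite starZ starM starK conjc_real.
  rewrite cnormZ cnorm_star sV ltr_pdivrMl// mulr1 ltrDl => /(_ e0).
  rewrite linearZ /= PE -rmorphM -(rmorph1 (real_complex R)) lecR.
  by rewrite ler_pdivrMl// mulr1.
have := state_CS phi 1 x.
rewrite star1 !mul1r state1 mul1r PE lecR => /le_trans /(_ PN).
by rewrite ler_sqr// nnegrE ?cnorm_ge0 ?cmod_ge0.
Qed.

End CStarTheory.

Section CProd.
Variables (R : realType) (I : pointedType) (A : I -> cstarType R).

(* The C*-direct product: bounded families, with the supremum norm. *)
Record cprod := CProd {
  cfam :> forall i, A i;
  cfam_bounded : exists K : R, forall i, cnorm (cfam i) <= K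
}.

HB.instance Definition _ := gen_eqMixin cprod.
HB.instance Definition _ := gen_choiceMixin cprod.

Lemma cprodP (a b : cprod) : (forall i, a i = b i) -> a = b.
Proof.
case: a b => [a pa] [b pb] /= ab.
have {}ab : a = b by exact: functional_extensionality_dep.
by move: pa pb; rewrite ab => pa pb; congr CProd; exact: Prop_irrelevance.
Qed.

Implicit Types a b : cprod.

Lemma cprod_add_subproof a b :
  exists K : R, forall i, cnorm (a i + b i) <= K.
Proof.
have [K KP] := cfam_bounded a; have [L LP] := cfam_bounded b.
by exists (K + L) => i; apply: (le_trans (cnormD _ _)); exact: lerD.
Qed.
Definition cprod_add a b := CProd (cprod_add_subproof a b).

Lemma cprod_opp_subproof a : exists K : R, forall i, cnorm (- a i) <= K.
Proof. by have [K KP] := cfam_bounded a; exists K => i; rewrite cnormN. Qed.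
Definition cprod_opp a := CProd (cprod_opp_subproof a).

Lemma cprod_mul_subproof a b :
  exists K : R, forall i, cnorm (a i * b i) <= K.
Proof.
have [K KP] := cfam_bounded a; have [L LP] := cfam_bounded b.
exists (K * L) => i; apply: (le_trans (cnormM _ _)).
by apply: ler_pM; rewrite ?cnorm_ge0.
Qed.
Definition cprod_mul a b := CProd (cprod_mul_subproof a b).

Lemma cprod_scale_subproof (c : R[i]) a :
  exists K : R, forall i, cnorm (c *: a i) <= K.
Proof.
have [K KP] := cfam_bounded a; exists (cmod c * K) => i.
by rewrite cnormZ ler_wpM2l ?cmod_ge0.
Qed.
Definition cprod_scale c a := CProd (cprod_scale_subproof c a).

Lemma cprod_star_subproof a : exists K : R, forall i, cnorm (star (a i)) <= K.
Proof. by have [K KP] := cfam_bounded a; exists K => i; rewrite cnorm_starE. Qed.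
Definition cprod_star a := CProd (cprod_star_subproof a).

Lemma cprod_zero_subproof : exists K : R, forall i, cnorm (0 : A i) <= K.
Proof. by exists 0 => i; rewrite cnorm0. Qed.
Definition cprod_zero := CProd cprod_zero_subproof.

Lemma cnorm1 (B : cstarType R) : cnorm (1 : B) <= 1.
Proof.
have := cnorm_star (1 : B); rewrite star1 mul1r.
have := cnorm_ge0 (1 : B); nra.
Qed.

Lemma cprod_one_subproof : exists K : R, forall i, cnorm (1 : A i) <= K.
Proof. by exists 1 => i; exact: cnorm1. Qed.
Definition cprod_one := CProd cprod_one_subproof.

Fact cprod_addA : associative cprod_add.
Proof. by move=> a b c; apply: cprodP => i /=; rewrite addrA. Qed.
Fact cprod_addC : commutative cprod_add.
Proof. by move=> a b; apply: cprodP => i /=; rewrite addrC. Qed.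
Fact cprod_add0 : left_id cprod_zero cprod_add.
Proof. by move=> a; apply: cprodP => i /=; rewrite add0r. Qed.
Fact cprod_addN : left_inverse cprod_zero cprod_opp cprod_add.
Proof. by move=> a; apply: cprodP => i /=; rewrite addNr. Qed.
HB.instance Definition _ :=
  GRing.isZmodule.Build cprod cprod_addA cprod_addC cprod_add0 cprod_addN.

Fact cprod_mulA : associative cprod_mul.
Proof. by move=> a b c; apply: cprodP => i /=; rewrite mulrA. Qed.
Fact cprod_mul1l : left_id cprod_one cprod_mul.
Proof. by move=> a; apply: cprodP => i /=; rewrite mul1r. Qed.
Fact cprod_mul1r : right_id cprod_one cprod_mul.
Proof. by move=> a; apply: cprodP => i /=; rewrite mulr1. Qed.
Fact cprod_mulDl : left_distributive cprod_mul +%R.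
Proof. by move=> a b c; apply: cprodP => i /=; rewrite mulrDl. Qed.
Fact cprod_mulDr : right_distributive cprod_mul +%R.
Proof. by move=> a b c; apply: cprodP => i /=; rewrite mulrDr. Qed.
Fact cprod_one_neq0 : cprod_one != 0.
Proof.
apply/eqP => /(congr1 (fun a : cprod => a point)) /= /eqP.
by rewrite oner_eq0.
Qed.
HB.instance Definition _ := GRing.Zmodule_isNzRing.Build cprod
  cprod_mulA cprod_mul1l cprod_mul1r cprod_mulDl cprod_mulDr cprod_one_neq0.

Fact cprod_scaleA (c d : R[i]) a :
  cprod_scale c (cprod_scale d a) = cprod_scale (c * d) a.
Proof. by apply: cprodP => i /=; rewrite scalerA. Qed.
Fact cprod_scale1 : left_id 1 cprod_scale.
Proof. by move=> a; apply: cprodP => i /=; rewrite scale1r. Qed.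
Fact cprod_scaleDr : right_distributive cprod_scale +%R.
Proof. by move=> c a b; apply: cprodP => i /=; rewrite scalerDr. Qed.
Fact cprod_scaleDl a : {morph cprod_scale^~ a : c d / c + d}.
Proof. by move=> c d; apply: cprodP => i /=; rewrite scalerDl. Qed.
HB.instance Definition _ := GRing.Zmodule_isLmodule.Build R[i] cprod
  cprod_scaleA cprod_scale1 cprod_scaleDr cprod_scaleDl.

Fact cprod_scaleAl (c : R[i]) a b : c *: (a * b) = (c *: a) * b.
Proof. by apply: cprodP => i /=; rewrite scalerAl. Qed.
HB.instance Definition _ :=
  GRing.Lmodule_isLalgebra.Build R[i] cprod cprod_scaleAl.
Fact cprod_scaleAr (c : R[i]) a b : c *: (a * b) = a * (c *: b).
Proof. by apply: cprodP => i /=; rewrite scalerAr. Qed.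
HB.instance Definition _ :=
  GRing.Lalgebra_isAlgebra.Build R[i] cprod cprod_scaleAr.

Fact cprod_starK : involutive cprod_star.
Proof. by move=> a; apply: cprodP => i /=; rewrite starK. Qed.
Fact cprod_starD : {morph cprod_star : a b / a + b}.
Proof. by move=> a b; apply: cprodP => i /=; rewrite starD. Qed.
Fact cprod_starZ (c : R[i]) a : cprod_star (c *: a) = conjc c *: cprod_star a.
Proof. by apply: cprodP => i /=; rewrite starZ. Qed.
Fact cprod_starM a b : cprod_star (a * b) = cprod_star b * cprod_star a.
Proof. by apply: cprodP => i /=; rewrite starM. Qed.
HB.instance Definition _ := Algebra_hasStar.Build R cprod
  cprod_starK cprod_starD cprod_starZ cprod_starM.

Definition cprod_norm a : R := sup (range (fun i => cnorm (a i))).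

Lemma cprod_norm_ub a i : cnorm (a i) <= cprod_norm a.
Proof.
apply: ub_le_sup; last by exists i.
by have [K KP] := cfam_bounded a; exists K => _ [j _ <-].
Qed.

Lemma cprod_norm_le a K : (forall i, cnorm (a i) <= K) -> cprod_norm a <= K.
Proof.
move=> aK; apply: ge_sup; first by exists (cnorm (a point)); exists point.
by move=> _ [j _ <-].
Qed.

Lemma cprod_norm_ge0 a : 0 <= cprod_norm a.
Proof. exact: le_trans (cnorm_ge0 _) (cprod_norm_ub a point). Qed.

Fact cprod_normD a b : cprod_norm (a + b) <= cprod_norm a + cprod_norm b.
Proof.
apply: cprod_norm_le => i; apply: (le_trans (cnormD _ _)).
by apply: lerD; exact: cprod_norm_ub.
Qed.

Lemma cprod_normZ_le (c : R[i]) a : cprod_norm (c *: a) <= cmod c * cprod_norm a.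
Proof.
apply: cprod_norm_le => i; rewrite cnormZ.
by apply: ler_wpM2l; [exact: cmod_ge0|exact: cprod_norm_ub].
Qed.

Fact cprod_normZ (c : R[i]) a : cprod_norm (c *: a) = cmod c * cprod_norm a.
Proof.
apply/eqP; rewrite eq_le cprod_normZ_le /=.
have [->|c0] := eqVneq c 0.
  by rewrite ComplexField.Normc.normc0 mul0r cprod_norm_ge0.
have := cprod_normZ_le c^-1 (c *: a); rewrite scalerA mulVf// scale1r.
rewrite ComplexField.Normc.normcV ler_pdivlMl//.
rewrite lt_def cmod_ge0 andbT; apply/eqP => /ComplexField.Normc.eq0_normc.
exact/eqP.
Qed.

Fact cprod_norm0_eq0 a : cprod_norm a = 0 -> a = 0.
Proof.
move=> a0; apply: cprodP => i; apply: cnorm0_eq0; apply/eqP.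
by rewrite eq_le cnorm_ge0 andbT -a0 cprod_norm_ub.
Qed.

Fact cprod_normM a b : cprod_norm (a * b) <= cprod_norm a * cprod_norm b.
Proof.
apply: cprod_norm_le => i; apply: (le_trans (cnormM _ _)).
by apply: ler_pM; rewrite ?cnorm_ge0 ?cprod_norm_ub.
Qed.

Fact cprod_norm_star a : cprod_norm (star a * a) = cprod_norm a ^+ 2.
Proof.
apply/eqP; rewrite eq_le; apply/andP; split.
  apply: cprod_norm_le => i; rewrite cnorm_star.
  by rewrite ler_sqr ?nnegrE ?cnorm_ge0 ?cprod_norm_ge0 ?cprod_norm_ub.
rewrite -ler_sqrt ?sqr_ge0 ?cprod_norm_ge0// sqrtr_sqr.
rewrite ger0_norm ?cprod_norm_ge0//; apply: cprod_norm_le => i.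
rewrite -[leLHS]ger0_norm ?cnorm_ge0// -sqrtr_sqr ler_sqrt ?cprod_norm_ge0//.
by rewrite -cnorm_star; exact: (cprod_norm_ub (star a * a)).
Qed.

Fact cprod_complete (u : nat -> cprod) :
  (forall e, 0 < e -> exists N, forall m n, (N <= m)%N -> (N <= n)%N ->
     cprod_norm (u m - u n) < e) ->
  exists l, forall e, 0 < e ->
    exists N, forall n, (N <= n)%N -> cprod_norm (u n - l) < e.
Proof.
move=> uC.
have lim i : exists l : A i, forall e, 0 < e ->
    exists N, forall n, (N <= n)%N -> cnorm (u n i - l) < e.
  apply: cnorm_complete => e /uC[N NP]; exists N => m n Nm Nn.
  exact: le_lt_trans (cprod_norm_ub (u m - u n) i) (NP _ _ Nm Nn).
pose l i := projT1 (cid (lim i)).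
have lP i : forall e, 0 < e ->
    exists N, forall n, (N <= n)%N -> cnorm (u n i - l i) < e.
  exact: projT2 (cid (lim i)).
have uni e : 0 < e ->
    exists N, forall n, (N <= n)%N -> forall i, cnorm (u n i - l i) <= e.
  move=> e0; have [N NP] := uC _ e0; exists N => n Nn i.
  apply/ler_addgt0Pr => d d0; have [M MP] := lP i _ d0.
  have -> : u n i - l i =
      (u n - u (maxn N M)) i + (u (maxn N M) i - l i) by rewrite /= addrA subrK.
  apply: (le_trans (cnormD _ _)); apply: lerD.
    apply: (le_trans (cprod_norm_ub _ _)); apply: ltW; apply: NP => //.
    exact: leq_maxl.
  by apply: ltW; apply: MP; exact: leq_maxr.
have lb : exists K : R, forall i, cnorm (l i) <= K.
  have [N /(_ _ (leqnn N)) NP] := uni _ ltr01.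
  exists (cprod_norm (u N) + 1) => i.
  have -> : l i = u N i - (u N i - l i) by rewrite opprB addrC subrK.
  apply: (le_trans (cnormD _ _)); rewrite cnormN; apply: lerD => //.
  exact: cprod_norm_ub.
exists (CProd lb) => e e0; have [N NP] := uni _ (divr_gt0 e0 (ltr0Sn R 1)).
exists N => n Nn; apply: (@le_lt_trans _ _ (e / 2%:R)).
  by apply: cprod_norm_le => i; exact: NP.
by rewrite ltr_pdivrMr// ltr_pMr// ltr1n.
Qed.

HB.instance Definition _ := StarAlgebra_isCStar.Build R cprod
  cprod_normD cprod_normZ cprod_norm0_eq0 cprod_normM cprod_norm_star
  cprod_complete.

End CProd.

Section UltraLimit.
Variables (R : realType) (I : Type) (alpha : set_system I).
Hypothesis ualpha : UltraFilter alpha.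

Definition ulim (f : I -> R[i]^o) : R[i] := lim (f @ alpha).

Lemma ultra_cvgR (f : I -> R) (K : R) : (forall i, `|f i| <= K) ->
  exists l : R, f @ alpha --> l.
Proof.
move=> fK; have := @segment_compact R (- K) K; rewrite compact_ultra.
have uf : UltraFilter (f @ alpha).
  split; first exact: fmap_proper_filter.
  move=> G GF fG; apply/seteqP; split => //= B GB.
  have [//|nB] := in_ultra_setVsetC (f @^-1` B) ualpha.
  have : G set0 by rewrite -(setICr B); apply: filterI => //; exact: fG.
  by move=> /filter_not_empty.
move=> /(_ _ uf) [|l [_ fl]]; last by exists l.
by apply: nearW => i; rewrite /= in_itv /= -ler_norml.
Qed.

Lemma cmodE (z : R[i]) : `|z| = (cmod z)%:C.
Proof. by rewrite normc_def; case: z. Qed.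

Lemma cvgcP (f : I -> R[i]^o) (z : R[i]^o) : f @ alpha --> z <->
  forall e : R, 0 < e -> \forall i \near alpha, cmod (z - f i) < e.
Proof.
split=> [/cvgrPdist_lt fz e e0|fz].
  have e0' : 0 < e%:C by rewrite ltcE /= eqxx.
  by have := fz _ e0'; apply: filterS => i; rewrite cmodE ltcR.
apply/cvgrPdist_lt => -[e e']; rewrite ltcE /= => /andP[/eqP -> e0].
by have := fz _ e0; apply: filterS => i; rewrite cmodE ltcR.
Qed.

Lemma cmod_le (x y : R) : cmod (x +i* y) <= `|x| + `|y|.
Proof.
have -> : x +i* y = (x +i* 0) + (0 +i* y) by simpc.
apply: (le_trans (le_normcD _ _)) => /=.
by rewrite expr0n addr0 add0r !sqrtr_sqr.
Qed.

Lemma Re_le (z : R[i]) : `|complex.Re z| <= cmod z.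
Proof. by case: z => x y /=; rewrite -sqrtr_sqr ler_wsqrtr// lerDl sqr_ge0. Qed.

Lemma Im_le (z : R[i]) : `|complex.Im z| <= cmod z.
Proof. by case: z => x y /=; rewrite -sqrtr_sqr ler_wsqrtr// lerDr sqr_ge0. Qed.

Lemma ulim_cvg (f : I -> R[i]^o) (K : R) : (forall i, cmod (f i) <= K) ->
  f @ alpha --> (ulim f : R[i]^o).
Proof.
move=> fK.
have [a fa] := @ultra_cvgR (fun i => complex.Re (f i)) K
   (fun i => le_trans (Re_le _) (fK i)).
have [b fb] := @ultra_cvgR (fun i => complex.Im (f i)) K
   (fun i => le_trans (Im_le _) (fK i)).
suff : f @ alpha --> (a +i* b : R[i]^o) by move=> /cvgP.
apply/cvgcP => e e0.
have e2 : 0 < e / 2%:R by rewrite divr_gt0.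
move/cvgrPdist_lt : fa => /(_ _ e2) fa; move/cvgrPdist_lt : fb => /(_ _ e2).
apply: filterS2 fa => i ai bi; rewrite (splitr e).
case: (f i) ai bi => x y /= ai bi.
by apply: (le_lt_trans (cmod_le (a - x) (b - y))); exact: ltrD.
Qed.

Lemma ulimE (f : I -> R[i]^o) (z : R[i]^o) : f @ alpha --> z -> ulim f = z.
Proof. move=> fz; exact: (@cvg_lim _ (@norm_hausdorff R[i] R[i]^o) _ _ _ _ _ fz). Qed.

Lemma ulim_ge0 (f : I -> R[i]^o) (z : R[i]) : f @ alpha --> (z : R[i]^o) ->
  (forall i, 0 <= f i) -> 0 <= z.
Proof.
move=> /cvgcP fz f0.
have H (e : R) : 0 < e -> `|complex.Im z| <= e /\ - complex.Re z <= e.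
  move=> e0; have [j] := @filter_ex _ _ _ _ (fz _ e0).
  have := f0 j; case: (f j) z {fz} => a b [x y]; rewrite lecE /=.
  move=> /andP[/eqP -> a0] h.
  have := le_lt_trans (Re_le ((x - a) +i* (y - 0))) h.
  have := le_lt_trans (Im_le ((x - a) +i* (y - 0))) h.
  rewrite /= subr0 => /ltW -> /=; rewrite ltr_norml => /andP[h1 _].
  by split=> //; lra.
rewrite lecE /=; apply/andP; split.
  rewrite -normr_eq0 eq_le normr_ge0 andbT; apply/ler_addgt0Pr => e /H[].
  by rewrite add0r.
rewrite -oppr_le0; apply/ler_addgt0Pr => e /H[_].
by rewrite add0r.
Qed.

End UltraLimit.

Section UltraState.
Variables (R : realType) (I : pointedType) (alpha : set_system I).
Hypothesis ualpha : UltraFilter alpha.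
Variables (A : I -> cstarType R) (phi : forall i, state (A i)).

Definition ulim_state_fun (a : cprod A) : R[i] :=
  ulim alpha (fun i => phi i (a i)).

Lemma ulim_state_cvg (a : cprod A) :
  (fun i => phi i (a i) : R[i]^o) @ alpha --> (ulim_state_fun a : R[i]^o).
Proof.
apply: (@ulim_cvg _ _ _ _ _ (cnorm a)) => i.
exact: le_trans (state_bound _ _) (cprod_norm_ub a i).
Qed.

Fact ulim_state_scalar : scalar ulim_state_fun.
Proof.
move=> c a b; apply: ulimE.
have -> : (fun i => phi i ((c *: a + b) i) : R[i]^o) =
    (fun i => c *: (phi i (a i) : R[i]^o) + (phi i (b i) : R[i]^o)).
  by apply/funext => i /=; rewrite linearP.
by apply: cvgD; [apply: cvgZr|]; exact: ulim_state_cvg.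
Qed.

HB.instance Definition _ :=
  GRing.isLinear.Build _ _ _ _ ulim_state_fun ulim_state_scalar.

Fact ulim_state_ge0 (a : cprod A) : 0 <= ulim_state_fun (star a * a).
Proof.
by apply: (ulim_ge0 _ (@ulim_state_cvg (star a * a))) => i; exact: state_ge0.
Qed.

Fact ulim_state1 : ulim_state_fun 1 = 1.
Proof.
apply: ulimE; apply: cvg_trans (@cvg_cst R[i]^o 1 _ alpha _).
by apply: near_eq_cvg; apply: nearW => i; rewrite state1.
Qed.

Definition ulim_state : state (cprod A) :=
  @State R (cprod A) ulim_state_fun ulim_state_ge0 ulim_state1.

End UltraState.

Record tracial_state (R : realType) (B : starAlgType R) := TracialState {
  ts_state :> state B;
  ts_tracial : forall a b, ts_state (a * b) = ts_state (b * a)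
}.

Section NullIdeal.
Variables (R : realType) (B : starAlgType R) (psi : tracial_state B).
Implicit Types a b : B.

Definition null_ideal : set B := [set a | psi (star a * a) = 0].

Lemma null_mull a b : null_ideal a -> psi (b * a) = 0.
Proof.
by move=> a0; rewrite -[b]starK state_conj state_null// rmorph0.
Qed.

Lemma null_ideal0 : null_ideal 0.
Proof. by rewrite /null_ideal /= mulr0 linear0. Qed.

Lemma null_idealD a b : null_ideal a -> null_ideal b -> null_ideal (a + b).
Proof.
move=> a0 b0; rewrite /null_ideal /= mulrDr linearD /=.
by rewrite null_mull// null_mull// addr0.
Qed.

Lemma null_idealMl b a : null_ideal a -> null_ideal (b * a).
Proof. by move=> a0; rewrite /null_ideal /= mulrA null_mull. Qed.

Lemma null_ideal_star a : null_ideal a -> null_ideal (star a).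
Proof. by rewrite /null_ideal /= starK ts_tracial. Qed.

Lemma null_idealMr a b : null_ideal a -> null_ideal (a * b).
Proof.
move=> a0; rewrite -[a * b]starK starM; apply: null_ideal_star.
exact/null_idealMl/null_ideal_star.
Qed.

Lemma null_idealZ (c : R[i]) a : null_ideal a -> null_ideal (c *: a).
Proof. by move=> a0; rewrite -[c *: a]mulr_algl; exact: null_idealMl. Qed.

Lemma null_idealN a : null_ideal a -> null_ideal (- a).
Proof. by rewrite -scaleN1r; exact: null_idealZ. Qed.

Definition null_equiv a b : bool := `[< null_ideal (a - b) >].

Lemma null_equiv_is_equiv : equiv_class_of null_equiv.
Proof.
split=> [a|a b|b a c].
- by apply/asboolP; rewrite subrr; exact: null_ideal0.
- by apply/asboolP/asboolP => /null_idealN; rewrite opprB.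
- move=> /asboolP ab /asboolP bc; apply/asboolP.
  by rewrite -(subrK b a) -addrA; exact: null_idealD.
Qed.

Canonical null_equiv_equiv := EquivRelPack null_equiv_is_equiv.

Definition tracial_quot := {eq_quot null_equiv}.

HB.instance Definition _ := Choice.on tracial_quot.
HB.instance Definition _ := EqQuotient.on tracial_quot.

Local Notation cls := (\pi_tracial_quot).

Lemma tquot_eqP a b : reflect (null_ideal (a - b)) (cls a == cls b :> tracial_quot).
Proof. by rewrite eqmodE; exact: asboolP. Qed.

Lemma tquot_eq a b : null_ideal (a - b) -> cls a = cls b :> tracial_quot.
Proof. by move=> /tquot_eqP /eqP. Qed.

Lemma tquot_repr a : null_ideal (repr (cls a : tracial_quot) - a).
Proof. by apply/tquot_eqP; rewrite reprK. Qed.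

Implicit Types x y z : tracial_quot.

Definition tquot_zero : tracial_quot := cls 0.
Definition tquot_one : tracial_quot := cls 1.
Definition tquot_opp x : tracial_quot := cls (- repr x).
Definition tquot_add x y : tracial_quot := cls (repr x + repr y).
Definition tquot_mul x y : tracial_quot := cls (repr x * repr y).
Definition tquot_scale (c : R[i]) x : tracial_quot := cls (c *: repr x).
Definition tquot_star x : tracial_quot := cls (star (repr x)).

Lemma tquot_oppE a : tquot_opp (cls a) = cls (- a).
Proof. by apply: tquot_eq; rewrite -opprD; exact/null_idealN/tquot_repr. Qed.

Lemma tquot_addE a b : tquot_add (cls a) (cls b) = cls (a + b).
Proof.
apply: tquot_eq; rewrite opprD addrACA.
by apply: null_idealD; exact: tquot_repr.
Qed.

Lemma tquot_mulE a b : tquot_mul (cls a) (cls b) = cls (a * b).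
Proof.
apply: tquot_eq; set a' := repr _; set b' := repr _.
have -> : a' * b' - a * b = (a' - a) * b' + a * (b' - b).
  by rewrite mulrBl mulrBr addrA subrK.
by apply: null_idealD; [apply: null_idealMr|apply: null_idealMl];
  exact: tquot_repr.
Qed.

Lemma tquot_scaleE (c : R[i]) a : tquot_scale c (cls a) = cls (c *: a).
Proof. by apply: tquot_eq; rewrite -scalerBr; exact/null_idealZ/tquot_repr. Qed.

Lemma tquot_starE a : tquot_star (cls a) = cls (star a).
Proof.
by apply: tquot_eq; rewrite -starB; exact/null_ideal_star/tquot_repr.
Qed.

Fact tquot_addA : associative tquot_add.
Proof.
elim/quotW=> a; elim/quotW=> b; elim/quotW=> c.
by rewrite (tquot_addE b c) (tquot_addE a b) !tquot_addE addrA.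
Qed.
Fact tquot_addC : commutative tquot_add.
Proof. by elim/quotW=> a; elim/quotW=> b; rewrite !tquot_addE addrC. Qed.
Fact tquot_add0 : left_id tquot_zero tquot_add.
Proof. by elim/quotW=> a; rewrite (tquot_addE 0 a) add0r. Qed.
Fact tquot_addN : left_inverse tquot_zero tquot_opp tquot_add.
Proof. by elim/quotW=> a; rewrite (tquot_oppE a) tquot_addE addNr. Qed.
HB.instance Definition _ :=
  GRing.isZmodule.Build tracial_quot tquot_addA tquot_addC tquot_add0 tquot_addN.

Lemma tquotD a b : cls (a + b) = cls a + cls b :> tracial_quot.
Proof. by rewrite -tquot_addE. Qed.

Fact tquot_mulA : associative tquot_mul.
Proof.
elim/quotW=> a; elim/quotW=> b; elim/quotW=> c.
by rewrite (tquot_mulE b c) (tquot_mulE a b) !tquot_mulE mulrA.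
Qed.
Fact tquot_mul1l : left_id tquot_one tquot_mul.
Proof. by elim/quotW=> a; rewrite (tquot_mulE 1 a) mul1r. Qed.
Fact tquot_mul1r : right_id tquot_one tquot_mul.
Proof. by elim/quotW=> a; rewrite (tquot_mulE a 1) mulr1. Qed.
Fact tquot_mulDl : left_distributive tquot_mul +%R.
Proof.
elim/quotW=> a; elim/quotW=> b; elim/quotW=> c.
rewrite -tquotD (tquot_mulE a c) (tquot_mulE b c) (tquot_mulE (a + b) c).
by rewrite mulrDl tquotD.
Qed.
Fact tquot_mulDr : right_distributive tquot_mul +%R.
Proof.
elim/quotW=> a; elim/quotW=> b; elim/quotW=> c.
rewrite -tquotD (tquot_mulE a b) (tquot_mulE a c) (tquot_mulE a (b + c)).
by rewrite mulrDr tquotD.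
Qed.
Fact tquot_one_neq0 : tquot_one != 0.
Proof.
apply/tquot_eqP; rewrite subr0 /null_ideal /= star1 mulr1 state1.
exact/eqP/oner_neq0.
Qed.
HB.instance Definition _ := GRing.Zmodule_isNzRing.Build tracial_quot
  tquot_mulA tquot_mul1l tquot_mul1r tquot_mulDl tquot_mulDr tquot_one_neq0.

Fact tquot_scaleA (c d : R[i]) x :
  tquot_scale c (tquot_scale d x) = tquot_scale (c * d) x.
Proof.
elim/quotW: x => a.
by rewrite (tquot_scaleE d a) (tquot_scaleE (c * d) a) tquot_scaleE scalerA.
Qed.
Fact tquot_scale1 : left_id 1 tquot_scale.
Proof. by elim/quotW=> a; rewrite (tquot_scaleE 1 a) scale1r. Qed.
Fact tquot_scaleDr : right_distributive tquot_scale +%R.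
Proof.
move=> c; elim/quotW=> a; elim/quotW=> b; rewrite -tquotD.
by rewrite (tquot_scaleE c a) (tquot_scaleE c b) tquot_scaleE scalerDr tquotD.
Qed.
Fact tquot_scaleDl x : {morph tquot_scale^~ x : c d / c + d}.
Proof.
move=> c d; elim/quotW: x => a /=.
rewrite (tquot_scaleE c a) (tquot_scaleE d a) (tquot_scaleE (c + d) a).
by rewrite scalerDl tquotD.
Qed.
HB.instance Definition _ := GRing.Zmodule_isLmodule.Build R[i] tracial_quot
  tquot_scaleA tquot_scale1 tquot_scaleDr tquot_scaleDl.

Lemma tquotM a b : cls (a * b) = cls a * cls b :> tracial_quot.
Proof. by rewrite -tquot_mulE. Qed.
Lemma tquotZ (c : R[i]) a : cls (c *: a) = c *: cls a :> tracial_quot.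
Proof. by rewrite -tquot_scaleE. Qed.

Fact tquot_scaleAl (c : R[i]) x y : c *: (x * y) = (c *: x) * y.
Proof.
elim/quotW: x => a; elim/quotW: y => b.
by rewrite -(tquotM a b) -!tquotZ -tquotM scalerAl.
Qed.
HB.instance Definition _ :=
  GRing.Lmodule_isLalgebra.Build R[i] tracial_quot tquot_scaleAl.
Fact tquot_scaleAr (c : R[i]) x y : c *: (x * y) = x * (c *: y).
Proof.
elim/quotW: x => a; elim/quotW: y => b.
by rewrite -(tquotM a b) -!tquotZ -tquotM scalerAr.
Qed.
HB.instance Definition _ :=
  GRing.Lalgebra_isAlgebra.Build R[i] tracial_quot tquot_scaleAr.

Fact tquot_starK : involutive tquot_star.
Proof. by elim/quotW=> a; rewrite (tquot_starE a) tquot_starE starK. Qed.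
Fact tquot_starD : {morph tquot_star : x y / x + y}.
Proof.
elim/quotW=> a; elim/quotW=> b.
by rewrite -tquotD (tquot_starE a) (tquot_starE b) tquot_starE starD tquotD.
Qed.
Fact tquot_starZ (c : R[i]) x : tquot_star (c *: x) = conjc c *: tquot_star x.
Proof.
elim/quotW: x => a.
by rewrite -tquotZ (tquot_starE a) tquot_starE starZ tquotZ.
Qed.
Fact tquot_starM x y : tquot_star (x * y) = tquot_star y * tquot_star x.
Proof.
elim/quotW: x => a; elim/quotW: y => b.
by rewrite -tquotM (tquot_starE a) (tquot_starE b) tquot_starE starM tquotM.
Qed.
HB.instance Definition _ := Algebra_hasStar.Build R tracial_quot
  tquot_starK tquot_starD tquot_starZ tquot_starM.

Lemma tquot_star_cls a : star (cls a : tracial_quot) = cls (star a).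
Proof. exact: tquot_starE. Qed.

Definition tquot_state_fun x : R[i] := psi (repr x).

Lemma tquot_state_funE a : tquot_state_fun (cls a) = psi a.
Proof.
apply/eqP; rewrite -subr_eq0 -linearB /= -[_ - _]mul1r; apply/eqP.
exact/null_mull/tquot_repr.
Qed.

Fact tquot_state_scalar : scalar tquot_state_fun.
Proof.
move=> c x y; elim/quotW: x => a; elim/quotW: y => b.
by rewrite -tquotZ -tquotD !tquot_state_funE linearP.
Qed.
HB.instance Definition _ :=
  GRing.isLinear.Build _ _ _ _ tquot_state_fun tquot_state_scalar.

Fact tquot_state_ge0 x : 0 <= tquot_state_fun (star x * x).
Proof.
elim/quotW: x => a; rewrite tquot_star_cls -tquotM tquot_state_funE.
exact: state_ge0.
Qed.

Fact tquot_state1 : tquot_state_fun 1 = 1.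
Proof. by rewrite tquot_state_funE state1. Qed.

Fact tquot_tracial x y : tquot_state_fun (x * y) = tquot_state_fun (y * x).
Proof.
elim/quotW: x => a; elim/quotW: y => b.
by rewrite -!tquotM !tquot_state_funE ts_tracial.
Qed.

Definition tquot_state : tracial_state tracial_quot :=
  @TracialState R tracial_quot
    (@State R tracial_quot tquot_state_fun tquot_state_ge0 tquot_state1)
    tquot_tracial.

End NullIdeal.

(* C*-subalgebras are unital. For maximal_tracial below this is no restriction:
   if M is a tracial C*-subalgebra, then so is M + C 1. *)
Record csubalg (R : realType) (A : cstarType R) := CSubalg {
  csub_set :> set A;
  csub1 : csub_set 1;
  csubD : forall a b, csub_set a -> csub_set b -> csub_set (a + b);
  csubZ : forall (c : R[i]) a, csub_set a -> csub_set (c *: a);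
  csubM : forall a b, csub_set a -> csub_set b -> csub_set (a * b);
  csub_star : forall a, csub_set a -> csub_set (star a);
  csub_closed : forall a,
    (forall e : R, 0 < e -> exists2 b, csub_set b & cnorm (a - b) < e) ->
    csub_set a
}.

Section CSubalgType.
Variables (R : realType) (A : cstarType R) (M : csubalg A).

Definition csub_pred : {pred A} := [pred a | `[< csub_set M a >]].

Record csub_type := CSubType {csub_val : A; _ : csub_val \in csub_pred}.

HB.instance Definition _ := [isSub for csub_val].
HB.instance Definition _ := [Choice of csub_type by <:].

Fact csub_subproof : GRing.subsemialg_closed csub_pred.
Proof.
split; first by apply/asboolP; exact: csub1.
- split; first by apply/asboolP; rewrite -(scale0r 1); exact/csubZ/csub1.
  by move=> a b /asboolP Ma /asboolP Mb; apply/asboolP; exact: csubD.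
- by move=> c a /asboolP Ma; apply/asboolP; exact: csubZ.
- by move=> a b /asboolP Ma /asboolP Mb; apply/asboolP; exact: csubM.
Qed.
HB.instance Definition _ :=
  GRing.SubChoice_isSubAlgebra.Build R[i] A csub_pred csub_type csub_subproof.

Fact csub_star_subproof (a : csub_type) : star (val a) \in csub_pred.
Proof. by case: a => a Ma; apply/asboolP/csub_star; exact/asboolP. Qed.
Definition csub_type_star (a : csub_type) := CSubType (csub_star_subproof a).

Fact csub_starK : involutive csub_type_star.
Proof. by move=> a; apply: val_inj; exact: starK. Qed.
Fact csub_starD : {morph csub_type_star : a b / a + b}.
Proof.
by move=> a b; apply: val_inj; exact: starD.
Qed.
Fact csub_starZ (c : R[i]) a :
  csub_type_star (c *: a) = conjc c *: csub_type_star a.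
Proof. by apply: val_inj; exact: starZ. Qed.
Fact csub_starM a b :
  csub_type_star (a * b) = csub_type_star b * csub_type_star a.
Proof. by apply: val_inj; exact: starM. Qed.
HB.instance Definition _ := Algebra_hasStar.Build R csub_type
  csub_starK csub_starD csub_starZ csub_starM.

Variable phi : state A.

Definition csub_state_fun (a : csub_type) : R[i] := phi (val a).
Fact csub_state_scalar : scalar csub_state_fun.
Proof. by move=> c a b; rewrite /csub_state_fun /= linearP. Qed.
HB.instance Definition _ :=
  GRing.isLinear.Build _ _ _ _ csub_state_fun csub_state_scalar.
Fact csub_state_ge0 (a : csub_type) : 0 <= csub_state_fun (star a * a).
Proof. exact: (state_ge0 phi (val a)). Qed.
Fact csub_state1 : csub_state_fun 1 = 1.
Proof. exact: (state1 phi). Qed.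
Definition csub_state : state csub_type :=
  @State R csub_type csub_state_fun csub_state_ge0 csub_state1.

End CSubalgType.

Section MaximalTracial.
Variables (R : realType) (A : cstarType R) (phi : state A).

Definition tracial_on (M : set A) : Prop :=
  forall a b, M a -> M b -> phi (a * b) = phi (b * a).

Definition maximal_tracial (M : csubalg A) : Prop :=
  tracial_on M /\
  forall N : csubalg A, tracial_on N -> M `<=` N -> N `<=` M.

Variables (M : csubalg A) (maxM : maximal_tracial M).

Fact csub_tracial (a b : csub_type M) :
  csub_state M phi (a * b) = csub_state M phi (b * a).
Proof. by apply: (proj1 maxM); [case: a|case: b] => c Mc; exact/asboolP. Qed.

Definition csub_tracial_state : tracial_state (csub_type M) :=
  TracialState csub_tracial.

(* M modulo its ideal of all a with phi (star a * a) = 0, as a *-algebra. *)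
Definition maximal_tracial_quot : starAlgType R :=
  tracial_quot csub_tracial_state.

Definition maximal_tracial_quot_state : tracial_state maximal_tracial_quot :=
  tquot_state csub_tracial_state.

End MaximalTracial.

HB.mixin Record CompleteNormedModule_hasInner (R : realType) H
    & CompleteNormedModule R[i] H := {
  inner : H -> H -> R[i];
  innerDl : forall x y z, inner (x + y) z = inner x z + inner y z;
  innerZl : forall (c : R[i]) x y, inner (c *: x) y = c * inner x y;
  inner_conj : forall x y, inner y x = conjc (inner x y);
  inner_norm : forall x, inner x x = `|x| ^+ 2
}.

#[short(type="hilbertType")]
HB.structure Definition Hilbert (R : realType) :=
  {H of CompleteNormedModule R[i] H & CompleteNormedModule_hasInner R H}.

Definition separable (T : topologicalType) : Prop :=
  exists2 D : set T, countable D & dense D.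

Section VonNeumann.
Variables (R : realType) (H : hilbertType R).
Implicit Types S T U : H -> H.

Definition bounded_operator T : Prop :=
  linear T /\ exists K : R, forall x, `|T x| <= K%:C * `|x|.

(* Adjoints are handled as a relation: S is the (unique) adjoint of T. *)
Definition is_adjoint T S : Prop := forall x y, inner (T x) y = inner x (S y).

Definition self_adjoint T : Prop := is_adjoint T T.

Definition operator_le S T : Prop := forall x, 0 <= inner (T x - S x) x.

(* Unital *-subalgebras of B(H) closed in the weak operator topology. *)
Record von_neumann (V : set (H -> H)) : Prop := VonNeumann {
  vn_bounded : V `<=` bounded_operator;
  vn1 : V idfun;
  vnD : forall S T, V S -> V T -> V (S \+ T);
  vnZ : forall (c : R[i]) T, V T -> V (c \*: T);
  vnM : forall S T, V S -> V T -> V (S \o T);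
  vn_adjoint : forall T, V T -> exists2 S, V S & is_adjoint T S;
  vn_weakly_closed : forall T, bounded_operator T ->
    (forall (n : nat) (x y : 'I_n -> H) (e : R), 0 < e ->
      exists2 S, V S & forall k, cmod (inner (T (x k) - S (x k)) (y k)) < e) ->
    V T
}.

Variables (V : set (H -> H)) (tau : (H -> H) -> R[i]).

Record operator_state : Prop := OperatorState {
  op_stateD : forall S T, V S -> V T -> tau (S \+ T) = tau S + tau T;
  op_stateZ : forall (c : R[i]) T, V T -> tau (c \*: T) = c * tau T;
  op_state_ge0 : forall T S, V T -> is_adjoint T S -> 0 <= tau (S \o T);
  op_state1 : tau idfun = 1
}.

Definition operator_tracial : Prop :=
  forall S T, V S -> V T -> tau (S \o T) = tau (T \o S).

Definition operator_faithful : Prop :=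
  forall T S, V T -> is_adjoint T S -> tau (S \o T) = 0 -> T = fun=> 0.

(* tau preserves suprema of increasing nets of self-adjoint elements of V; a
   net is represented by its range, an upward directed set. *)
Definition operator_normal : Prop :=
  forall (D : set (H -> H)) S,
    D !=set0 -> (forall T, D T -> V T /\ self_adjoint T) ->
    (forall T1 T2, D T1 -> D T2 ->
      exists2 T, D T & operator_le T1 T /\ operator_le T2 T) ->
    V S -> self_adjoint S -> (forall T, D T -> operator_le T S) ->
    (forall U, V U -> self_adjoint U -> (forall T, D T -> operator_le T U) ->
      operator_le S U) ->
    complex.Re (tau S) = sup [set complex.Re (tau T) | T in D].

Record operator_star_morphism (Q : starAlgType R) (pi : (H -> H) -> Q) : Prop :=
  OperatorStarMorphism {
  op_morph1 : pi idfun = 1;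
  op_morphD : forall S T, V S -> V T -> pi (S \+ T) = pi S + pi T;
  op_morphZ : forall (c : R[i]) T, V T -> pi (c \*: T) = c *: pi T;
  op_morphM : forall S T, V S -> V T -> pi (S \o T) = pi S * pi T;
  op_morph_star : forall T S, V T -> is_adjoint T S -> pi S = star (pi T)
}.

End VonNeumann.

Definition finite_dimensional (R : realType) (B : lmodType R[i]) : Prop :=
  exists (n : nat) (b : 'I_n -> B), forall v, exists c : 'I_n -> R[i],
    v = \sum_(k < n) c k *: b k.

(* Free ultrafilters; an ultrafilter is fixed iff it is some principal_filter i. *)
Definition nonprincipal (I : Type) (alpha : set_system I) : Prop :=
  forall i, alpha <> principal_filter i.

(* Main.v *)
Require Import Defs.
From HB Require Import structures.
From mathcomp Require Import all_boot all_order all_algebra.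
From mathcomp Require Import complex.
From mathcomp Require Import boolp classical_sets functions cardinality.
From mathcomp Require Import reals topology normedtype sequences.
From mathcomp Require Import ring lra.
Set Implicit Arguments.
Unset Strict Implicit.
Unset Printing Implicit Defensive.
Import Order.TTheory GRing.Theory Num.Theory.
Import numFieldNormedType.Exports.
Local Open Scope classical_set_scope.
Local Open Scope ring_scope.
Local Open Scope complex_scope.

(** Left multiplication represents the von Neumann algebra [V] on the
    pre-Hilbert space that the trace puts on [V] itself, where [<v, w>] is
    [tau (v^* w)]; there [tau] is the vector state of the unit [1], whether or
    not it is one on [H].  The whole proof takes place in this GNS space.

    Finite orthonormal systems containing [1] (a [frame]) compress left
    multiplication by [a] to a matrix of operator norm at most that of [a], and
    the vector [1] becomes a basis vector, whose vector state on matrices takes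
    the value [tau a] at the compression of [a].  By Gram-Schmidt the frames
    whose span contains given vectors generate a proper filter; along an
    ultrafilter refining it, the compressions of [a] converge strongly to [a].
    They are not multiplicative, but the bounded families of matrices that
    converge strongly, together with their adjoints, to left multiplication by
    some element of [V] form a *-algebra [S] with a multiplicative limit, and
    the limit state of such a family is the trace of its limit
    ([strong_lim_state]).  Hence the limit state is tracial on [S], and a family
    in [S] with limit 0 is null for it.  Zorn's lemma embeds [S] in a maximal
    tracial C*-algebra [M] ([maximal_tracial_extension]); modulo the null ideal
    of [M] the compressions become a *-homomorphism on [V], which carries the
    state of the quotient back to [tau] ([tracial_embedding]).

    This works for every *-algebra with a tracial state for which left
    multiplications are bounded on the GNS space.  For a von Neumann algebra
    the bound is the inequality [tau (b^* a^* a b) <= K^2 tau (b^* b)] for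
    [K] a bound of [a].  It holds because [tau] is monotone for the operator
    order, which is normality applied to the chain formed by two comparable
    operators ([normal_monotone]).

    The matrices carry the norm that the same bounds define ([left_norm]): the
    operator norm of left multiplications on the GNS space of a state is a
    C*-seminorm as soon as it is finite, and for the state taking the upper
    left entry of a matrix it is the usual operator norm on column vectors. *)

(** * The GNS seminorm of a state *)

Section StateSeminorm.
Variables (R : realType) (A : starAlgType R) (phi : state A).
Implicit Types (a b x y : A) (K L : R).

Definition snorm x : R := Num.sqrt (complex.Re (phi (star x * x))).

Lemma snorm_ge0 x : 0 <= snorm x.
Proof. exact: sqrtr_ge0. Qed.

Lemma snormE x : phi (star x * x) = (snorm x ^+ 2)%:C.
Proof.
have p0 := state_ge0 phi x.
rewrite sqr_sqrtr; last by move: p0; rewrite lecE /= => /andP[].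
by have := ger0_Im p0; case: (phi _) => u v /= ->.
Qed.

Lemma snorm_CS x y : cmod (phi (star x * y)) <= snorm x * snorm y.
Proof.
have := state_CS phi x y; rewrite !snormE -rmorphM lecR -exprMn.
by rewrite ler_sqr // nnegrE ?cmod_ge0 ?mulr_ge0 ?snorm_ge0.
Qed.

Lemma snorm_eq0 x : phi (star x * x) = 0 <-> snorm x = 0.
Proof.
rewrite snormE; split=> [/complexI/eqP|->]; last by rewrite expr0n.
by rewrite sqrf_eq0 => /eqP.
Qed.

Lemma snormZ (c : R[i]) x : snorm (c *: x) = cmod c * snorm x.
Proof.
rewrite -[RHS]ger0_norm ?mulr_ge0 ?cmod_ge0 ?snorm_ge0 // -sqrtr_sqr.
congr Num.sqrt; rewrite starZ -!(@scalerAl _ A) -!(@scalerAr _ A).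
by rewrite !linearZ /= snormE mulrA [conjc c * c]mulrC mulcJE -rmorphM exprMn.
Qed.

Lemma snorm0 : snorm 0 = 0.
Proof. by apply/snorm_eq0; rewrite mulr0 linear0. Qed.

Lemma snormD x y : snorm (x + y) <= snorm x + snorm y.
Proof.
rewrite -ler_sqr ?nnegrE ?addr_ge0 ?snorm_ge0 // -lecR -snormE.
rewrite starD mulrDl !mulrDr !linearD /= !snormE.
have xy := snorm_CS x y; rewrite (state_conj phi x y).
move: (phi (star x * y)) xy => z zxy.
have /(le_trans (ler_norm _)) : `|complex.Re z| <= snorm x * snorm y.
  exact: le_trans (Re_le z) zxy.
case: z {zxy} => u v /= h; rewrite lecE /= !add0r !addr0.
by rewrite subrr eqxx /=; lra.
Qed.

Definition left_bound K a := 0 <= K /\ forall x, snorm (a * x) <= K * snorm x.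

Lemma left_boundD K L a b :
  left_bound K a -> left_bound L b -> left_bound (K + L) (a + b).
Proof.
move=> [K0 Ka] [L0 Lb]; split=> [|x]; first exact: addr_ge0.
by rewrite !mulrDl; apply: (le_trans (snormD _ _)); exact: lerD.
Qed.

Lemma left_boundZ K a (c : R[i]) :
  left_bound K a -> left_bound (cmod c * K) (c *: a).
Proof.
move=> [K0 Ka]; split=> [|x]; first by rewrite mulr_ge0 ?cmod_ge0.
by rewrite -scalerAl snormZ -mulrA ler_wpM2l ?cmod_ge0.
Qed.

Lemma left_boundM K L a b :
  left_bound K a -> left_bound L b -> left_bound (K * L) (a * b).
Proof.
move=> [K0 Ka] [L0 Lb]; split=> [|x]; first exact: mulr_ge0.
by rewrite -!mulrA; apply: (le_trans (Ka _)); exact: ler_wpM2l.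
Qed.

Lemma snorm_adjoint a x :
  snorm (star a * x) ^+ 2 <= snorm x * snorm (a * (star a * x)).
Proof.
have := snorm_CS x (a * (star a * x)).
have -> : star x * (a * (star a * x)) = star (star a * x) * (star a * x).
  by rewrite [star (_ * _)]starM starK -!mulrA.
by rewrite snormE /= expr0n addr0 sqrtr_sqr ger0_norm ?sqr_ge0.
Qed.

(** Boundedness passes to adjoints although the space need not be complete:
    [||a^* x||^2 = <x, a a^* x> <= K ||x|| ||a^* x||]. *)
Lemma left_bound_star K a : left_bound K a -> left_bound K (star a).
Proof.
move=> [K0 Ka]; split=> // x; have := snorm_adjoint a x.
have := snorm_ge0 (star a * x); rewrite le_eqVlt => /orP[/eqP <- _|p0].
  by rewrite mulr_ge0 ?snorm_ge0.
have /(ler_wpM2l (snorm_ge0 x)) h := Ka (star a * x).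
by move=> /le_trans/(_ h); rewrite mulrCA mulrA expr2 (ler_pM2r p0).
Qed.

Lemma left_bound_sum (J : finType) (F : J -> A) (k : J -> R) :
  (forall j, left_bound (k j) (F j)) ->
  left_bound (\sum_j k j) (\sum_j F j).
Proof.
move=> kF; elim/big_rec2: _ => [|j u y _ h]; last exact: left_boundD.
by split=> // x; rewrite !mul0r snorm0.
Qed.

Hypothesis bounded : forall a, exists K, left_bound K a.

Definition left_norm a : R := inf [set K | left_bound K a].

Let left_has_inf a : has_inf [set K | left_bound K a].
Proof. by split; [exact: bounded | exists 0 => K []]. Qed.

Lemma left_norm_le K a : left_bound K a -> left_norm a <= K.
Proof. by move=> Ka; apply: ge_inf => //; exact: (left_has_inf a).2. Qed.

Lemma left_norm_ge0 a : 0 <= left_norm a.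
Proof. by apply: lb_le_inf => [|K []//]; exact: (left_has_inf a).1. Qed.

(** The infimum is attained: where [snorm x] vanishes any bound will do, and
    elsewhere one can divide by it. *)
Lemma left_norm_bound a : left_bound (left_norm a) a.
Proof.
split=> [|x]; first exact: left_norm_ge0.
have := snorm_ge0 x; rewrite le_eqVlt => /orP[/eqP x0|x0].
  by have [K [_ /(_ x)]] := bounded a; rewrite -x0 !mulr0.
rewrite -ler_pdivrMr //; apply: lb_le_inf; first exact: (left_has_inf a).1.
by move=> K [_ /(_ x)]; rewrite ler_pdivrMr.
Qed.

Lemma left_normD a b : left_norm (a + b) <= left_norm a + left_norm b.
Proof. by apply: left_norm_le; apply: left_boundD; exact: left_norm_bound. Qed.

Lemma left_normM a b : left_norm (a * b) <= left_norm a * left_norm b.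
Proof. by apply: left_norm_le; apply: left_boundM; exact: left_norm_bound. Qed.

Lemma left_normZ (c : R[i]) a : left_norm (c *: a) = cmod c * left_norm a.
Proof.
have le d b : left_norm (d *: b) <= cmod d * left_norm b.
  by apply: left_norm_le; apply: left_boundZ; exact: left_norm_bound.
apply/eqP; rewrite eq_le le /=.
have [->|c0] := eqVneq c 0.
  by rewrite ComplexField.Normc.normc0 mul0r left_norm_ge0.
have := le c^-1 (c *: a); rewrite scalerA mulVf // scale1r.
rewrite ComplexField.Normc.normcV ler_pdivlMl //.
rewrite lt_def cmod_ge0 andbT; apply/eqP => /ComplexField.Normc.eq0_normc.
exact/eqP.
Qed.

(** Half of the C*-identity is
    [||a x||^2 = <x, a^* a x> <= ||a^* a|| ||x||^2]. *)
Lemma left_norm_star a : left_norm (star a * a) = left_norm a ^+ 2.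
Proof.
have s b : left_norm (star b) <= left_norm b.
  by apply: left_norm_le; apply: left_bound_star; exact: left_norm_bound.
apply/eqP; rewrite eq_le; apply/andP; split.
  by apply: (le_trans (left_normM _ _)); rewrite expr2 ler_wpM2r ?left_norm_ge0.
set K := left_norm (star a * a).
have K0 : 0 <= K by exact: left_norm_ge0.
rewrite -[K]sqr_sqrtr // ler_sqr ?nnegrE ?sqrtr_ge0 ?left_norm_ge0 //.
apply: left_norm_le; split=> [|x]; first exact: sqrtr_ge0.
rewrite -ler_sqr ?nnegrE ?mulr_ge0 ?sqrtr_ge0 ?snorm_ge0 //.
rewrite exprMn (sqr_sqrtr K0).
have := snorm_adjoint (star a) x; rewrite starK => /le_trans; apply.
rewrite expr2 mulrCA; apply: ler_wpM2l; first exact: snorm_ge0.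
by rewrite mulrA; exact: (left_norm_bound (star a * a)).2.
Qed.

End StateSeminorm.

(** * Matrix algebras as C*-algebras *)

Lemma cauchyR_cvg (R : realType) (u : nat -> R) :
  (forall e, 0 < e -> exists N, forall k l, (N <= k)%N -> (N <= l)%N ->
     `|u k - u l| < e) ->
  exists a, forall e, 0 < e -> exists N, forall k, (N <= k)%N -> `|u k - a| < e.
Proof.
move=> uC; have /cvg_ex [a ua] : cvg (u @ \oo).
  apply/cauchy_cvgP/cauchy_exP => e /uC[N NP]; exists (u N).
  by exists N => // k Nk; rewrite -ball_normE /=; exact: NP.
exists a => e e0; have /cvgrPdist_lt/(_ e e0)[N _ NP] := ua.
by exists N => k /NP; rewrite distrC.
Qed.

Lemma cauchyC_cvg (R : realType) (u : nat -> R[i]) :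
  (forall e, 0 < e -> exists N, forall k l, (N <= k)%N -> (N <= l)%N ->
     cmod (u k - u l) < e) ->
  exists a, forall e, 0 < e ->
    exists N, forall k, (N <= k)%N -> cmod (u k - a) < e.
Proof.
move=> uC.
have [|a aP] := @cauchyR_cvg R (fun k => complex.Re (u k)).
  move=> e /uC[N NP]; exists N => k l Nk Nl.
  by rewrite -raddfB (le_lt_trans (Re_le _)) ?NP.
have [|b bP] := @cauchyR_cvg R (fun k => complex.Im (u k)).
  move=> e /uC[N NP]; exists N => k l Nk Nl.
  by rewrite -raddfB (le_lt_trans (Im_le _)) ?NP.
exists (a +i* b) => e e0.
have e2 : 0 < e / 2%:R by rewrite divr_gt0.
have [N NP] := aP _ e2; have [L LP] := bP _ e2.
exists (maxn N L) => k; rewrite geq_max => /andP[/NP ka /LP kb].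
rewrite (splitr e); apply: le_lt_trans (ltrD ka kb).
by case: (u k) => x y; exact: cmod_le.
Qed.

Section MatrixStar.
Variables (R : realType) (n : nat).
Local Notation C := R[i].
Local Notation M := 'M[C]_n.+1.
Implicit Types (A B X : M).

Definition mxstar A : M := \matrix_(i, j) conjc (A j i).

Fact mxstarK : involutive mxstar.
Proof. by move=> A; apply/matrixP => i j; rewrite !mxE conjcK. Qed.

Fact mxstarD : {morph mxstar : A B / A + B}.
Proof. by move=> A B; apply/matrixP => i j; rewrite !mxE rmorphD. Qed.

Fact mxstarZ (c : C) A : mxstar (c *: A) = conjc c *: mxstar A.
Proof. by apply/matrixP => i j; rewrite !mxE rmorphM. Qed.

Fact mxstarM A B : mxstar (A * B) = mxstar B * mxstar A.
Proof.
apply/matrixP => i j; rewrite !mxE rmorph_sum; apply: eq_bigr => k _.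
by rewrite !mxE rmorphM mulrC.
Qed.

HB.instance Definition _ := Algebra_hasStar.Build R M
  mxstarK mxstarD mxstarZ mxstarM.

Definition mxdiag_entry (k : 'I_n.+1) A : C := A k k.

Fact mxdiag_entry_scalar k : scalar (mxdiag_entry k).
Proof. by move=> c A B; rewrite /mxdiag_entry !mxE. Qed.
HB.instance Definition _ k :=
  GRing.isLinear.Build _ _ _ _ (mxdiag_entry k) (mxdiag_entry_scalar k).

Lemma mxdiag_entryE k A :
  mxdiag_entry k (star A * A) = (\sum_i cmod (A i k) ^+ 2)%:C.
Proof.
rewrite /mxdiag_entry mxE rmorph_sum; apply: eq_bigr => i _.
by rewrite !mxE mulrC mulcJE.
Qed.

Fact mxdiag_entry_ge0 k A : 0 <= mxdiag_entry k (star A * A).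
Proof. by rewrite mxdiag_entryE ler0c sumr_ge0 // => i _; exact: sqr_ge0. Qed.

Fact mxdiag_entry1 k : mxdiag_entry k 1 = 1.
Proof. by rewrite /mxdiag_entry mxE eqxx. Qed.

Definition mxstate (k : 'I_n.+1) : state M :=
  @State R M (mxdiag_entry k) (mxdiag_entry_ge0 k) (mxdiag_entry1 k).

(** The Euclidean norm of the first column.  Square matrices stand for column
    vectors here, so that the GNS seminorm of a state applies: left
    multiplication by [A] acts on first columns as the operator [A]. *)
Definition colnorm A : R := snorm (mxstate ord0) A.

Lemma colnorm_sqr A : colnorm A ^+ 2 = \sum_i cmod (A i ord0) ^+ 2.
Proof. by apply: complexI; rewrite -snormE; exact: mxdiag_entryE. Qed.

Lemma entry_le_colnorm A i : cmod (A i ord0) <= colnorm A.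
Proof.
rewrite -ler_sqr ?nnegrE ?cmod_ge0 ?snorm_ge0 // colnorm_sqr.
by rewrite (bigD1 i) //= lerDl sumr_ge0 // => j _; exact: sqr_ge0.
Qed.

Lemma left_bound_delta i j : left_bound (mxstate ord0) 1 (delta_mx i j : M).
Proof.
split=> // X; rewrite mul1r.
rewrite -ler_sqr ?nnegrE ?snorm_ge0 // !colnorm_sqr.
have E k : (delta_mx i j * X) k ord0 = (k == i)%:R * X j ord0.
  rewrite mxE (bigD1 j) //= big1 ?addr0 => [|l /negbTE lj].
    by rewrite mxE eqxx andbT.
  by rewrite mxE lj andbF mul0r.
rewrite (bigD1 i) //= big1 ?addr0 => [|k /negbTE ki]; last first.
  by rewrite E ki mul0r ComplexField.Normc.normc0 expr0n.
rewrite E eqxx mul1r (bigD1 j) //= lerDl.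
by rewrite sumr_ge0 // => k _; exact: sqr_ge0.
Qed.

(** With [entry_le_mxnorm], this compares the operator norm with the entries,
    which gives boundedness and reduces completeness to that of the scalars. *)
Lemma left_bound_entries A :
  left_bound (mxstate ord0) (\sum_i \sum_j cmod (A i j)) A.
Proof.
rewrite {2}[A]matrix_sum_delta; apply: left_bound_sum => i.
apply: left_bound_sum => j; rewrite -[cmod _]mulr1.
exact/left_boundZ/left_bound_delta.
Qed.

Lemma mx_bounded A : exists K, left_bound (mxstate ord0) K A.
Proof. by eexists; exact: left_bound_entries. Qed.

Definition mxnorm A : R := left_norm (mxstate ord0) A.

Lemma entry_le_mxnorm A i j : cmod (A i j) <= mxnorm A.
Proof.
have [_ /(_ (delta_mx j ord0))] := left_norm_bound mx_bounded A.
have -> : snorm (mxstate ord0) (delta_mx j ord0) = 1.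
  apply/eqP; rewrite -(@eqrXn2 _ 2) ?snorm_ge0 // expr1n colnorm_sqr.
  rewrite (bigD1 j) //= big1 ?addr0 => [|k /negbTE kj].
    by rewrite mxE !eqxx /= expr1n expr0n addr0 sqrtr1 expr1n.
  by rewrite mxE kj ComplexField.Normc.normc0 expr0n.
rewrite mulr1; apply: le_trans.
apply: le_trans (entry_le_colnorm _ i); rewrite mxE (bigD1 j) //= big1.
  by rewrite mxE !eqxx mulr1 addr0.
by move=> k /negbTE kj; rewrite mxE kj mulr0.
Qed.

Fact mxnorm0_eq0 A : mxnorm A = 0 -> A = 0.
Proof.
move=> A0; apply/matrixP => i j; rewrite mxE.
apply/ComplexField.Normc.eq0_normc/eqP.
by rewrite eq_le cmod_ge0 andbT -A0 entry_le_mxnorm.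
Qed.

Fact mx_complete (u : nat -> M) :
  (forall e, 0 < e -> exists N, forall k l, (N <= k)%N -> (N <= l)%N ->
     mxnorm (u k - u l) < e) ->
  exists A, forall e, 0 < e ->
    exists N, forall k, (N <= k)%N -> mxnorm (u k - A) < e.
Proof.
move=> uC.
have lim i j : exists a, forall e, 0 < e ->
    exists N, forall k, (N <= k)%N -> cmod (u k i j - a) < e.
  apply: cauchyC_cvg => e /uC[N NP]; exists N => k l Nk Nl.
  have := entry_le_mxnorm (u k - u l) i j; rewrite !mxE => /le_lt_trans.
  by apply; exact: NP.
pose A : M := \matrix_(i, j) projT1 (cid (lim i j)).
have AP i j e : 0 < e ->
    exists N, forall k, (N <= k)%N -> cmod (u k i j - A i j) < e.
  by move=> e0; rewrite mxE; exact: (projT2 (cid (lim i j))).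
exists A => e e0.
pose d := e / (n.+1 * n.+1).+1%:R.
have d0 : 0 < d by rewrite divr_gt0.
pose N i j := projT1 (cid (AP i j _ d0)).
exists (\max_i \max_j N i j)%N => k Nk.
apply: le_lt_trans (left_norm_le _ (left_bound_entries _)) _.
  exact: mx_bounded.
apply: (@le_lt_trans _ _ (\sum_(i < n.+1) \sum_(j < n.+1) d)).
  apply: ler_sum => i _; apply: ler_sum => j _; apply: ltW.
  have -> : (u k - A) i j = u k i j - A i j by rewrite !mxE.
  apply: (projT2 (cid (AP i j _ d0)) k).
  apply: leq_trans Nk.
  exact: leq_trans (leq_bigmax j) (leq_bigmax (F := fun i => \max_j N i j) i).
rewrite !sumr_const card_ord -mulrnA -mulr_natr mulrAC ltr_pdivrMr //.
by rewrite ltr_pM2l // ltr_nat.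
Qed.

HB.instance Definition _ := StarAlgebra_isCStar.Build R M
  (left_normD mx_bounded) (left_normZ mx_bounded) mxnorm0_eq0
  (left_normM mx_bounded) (left_norm_star mx_bounded) mx_complete.

Lemma mx_finite_dimensional : finite_dimensional M.
Proof.
exists (n.+1 * n.+1)%N, (fun k => vec_mx (delta_mx ord0 k)) => A.
exists (fun k => mxvec A ord0 k).
rewrite -[LHS]mxvecK [mxvec A in LHS]row_sum_delta linear_sum /=.
by apply: eq_bigr => k _; rewrite linearZ.
Qed.

Lemma colnorm_mul_le A X : colnorm (A * X) <= cnorm A * colnorm X.
Proof. exact: (left_norm_bound mx_bounded A).2. Qed.

Lemma cnorm_mx_le K A :
  0 <= K -> (forall X, colnorm (A * X) <= K * colnorm X) -> cnorm A <= K.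
Proof. by move=> K0 KA; apply: (left_norm_le mx_bounded). Qed.

End MatrixStar.

(** * Maximal tracial C*-subalgebras *)

Section MaximalExtension.
Variables (R : realType) (A : cstarType R) (phi : state A).
Implicit Types (a b c : A) (S : set A).

Record star_subalg S : Prop := StarSubalg {
  ssub1 : S 1;
  ssubD : forall a b, S a -> S b -> S (a + b);
  ssubZ : forall (c : R[i]) a, S a -> S (c *: a);
  ssubM : forall a b, S a -> S b -> S (a * b);
  ssub_star : forall a, S a -> S (star a)
}.

Definition norm_closure S : set A :=
  [set a | forall e : R, 0 < e -> exists2 b, S b & cnorm (a - b) < e].

Lemma sub_norm_closure S : S `<=` norm_closure S.
Proof. by move=> a Sa e e0; exists a => //; rewrite subrr cnorm0. Qed.

Lemma norm_closure_idem S a :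
  (forall e : R, 0 < e -> exists2 b, norm_closure S b & cnorm (a - b) < e) ->
  norm_closure S a.
Proof.
move=> Sa e e0; have e2 : 0 < e / 2%:R by rewrite divr_gt0.
have [b /(_ _ e2)[c Sc bc] ab] := Sa _ e2; exists c => //.
rewrite -(subrK b a) -addrA (splitr e).
exact: le_lt_trans (cnormD _ _) (ltrD ab bc).
Qed.

Lemma norm_closureD S a b : star_subalg S ->
  norm_closure S a -> norm_closure S b -> norm_closure S (a + b).
Proof.
move=> SS Sa Sb e e0; have e2 : 0 < e / 2%:R by rewrite divr_gt0.
have [a' Sa' aa'] := Sa _ e2; have [b' Sb' bb'] := Sb _ e2.
exists (a' + b'); first exact: ssubD.
rewrite opprD addrACA (splitr e).
exact: le_lt_trans (cnormD _ _) (ltrD aa' bb').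
Qed.

Lemma norm_closureZ S (c : R[i]) a : star_subalg S ->
  norm_closure S a -> norm_closure S (c *: a).
Proof.
move=> SS Sa e e0; have c1 : 0 < cmod c + 1 by rewrite ltr_wpDl ?cmod_ge0.
have [a' Sa' aa'] := Sa _ (divr_gt0 e0 c1).
exists (c *: a'); first exact: ssubZ.
rewrite -scalerBr cnormZ; move: aa'; rewrite ltr_pdivlMr //.
apply: le_lt_trans; rewrite mulrDr mulr1 mulrC lerDl; exact: cnorm_ge0.
Qed.

Lemma norm_closure_star S a : star_subalg S ->
  norm_closure S a -> norm_closure S (star a).
Proof.
move=> SS Sa e /Sa[b Sb ab]; exists (star b); first exact: ssub_star.
by rewrite -starB cnorm_starE.
Qed.

Lemma norm_closureM S a b : star_subalg S ->
  norm_closure S a -> norm_closure S b -> norm_closure S (a * b).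
Proof.
move=> SS Sa Sb.
have left c : S c -> norm_closure S (c * b).
  move=> Sc e e0; have c1 : 0 < cnorm c + 1 by rewrite ltr_wpDl ?cnorm_ge0.
  have [b' Sb' bb'] := Sb _ (divr_gt0 e0 c1).
  exists (c * b'); first exact: ssubM.
  rewrite -mulrBr; apply: le_lt_trans (cnormM _ _) _.
  move: bb'; rewrite ltr_pdivlMr //.
  by apply: le_lt_trans; rewrite mulrDr mulr1 mulrC lerDl; exact: cnorm_ge0.
apply: norm_closure_idem => e e0.
have b1 : 0 < cnorm b + 1 by rewrite ltr_wpDl ?cnorm_ge0.
have [a' Sa' aa'] := Sa _ (divr_gt0 e0 b1).
exists (a' * b); first exact: left.
rewrite -mulrBl; apply: le_lt_trans (cnormM _ _) _.
move: aa'; rewrite ltr_pdivlMr //.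
by apply: le_lt_trans; rewrite mulrDr mulr1 lerDl; exact: cnorm_ge0.
Qed.

Definition csubalg_closure S (SS : star_subalg S) : csubalg A :=
  @CSubalg R A (norm_closure S) (sub_norm_closure (ssub1 SS))
    (fun a b => @norm_closureD S a b SS)
    (fun (c : R[i]) a => @norm_closureZ S c a SS)
    (fun a b => @norm_closureM S a b SS) (fun a => @norm_closure_star S a SS)
    (@norm_closure_idem S).

Lemma csubalg_star_subalg (M : csubalg A) : star_subalg M.
Proof.
by split; [exact: csub1|exact: csubD|exact: csubZ|exact: csubM|exact: csub_star].
Qed.

(** Commutation under [phi] is a closed condition in one variable, because
    states are contractive; tracial sets are treated one variable at a time. *)
Lemma commute_closure S b :
  (forall a, S a -> phi (a * b) = phi (b * a)) ->
  forall a, norm_closure S a -> phi (a * b) = phi (b * a).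
Proof.
move=> Sb a Sa; apply/eqP; rewrite -subr_eq0.
apply/eqP/ComplexField.Normc.eq0_normc/eqP; rewrite eq_le cmod_ge0 andbT.
apply/ler_addgt0Pr => e e0; rewrite add0r.
have d0 : 0 < cnorm b *+ 2 + 1 by rewrite ltr_wpDl ?mulrn_wge0 ?cnorm_ge0.
have [c Sc ac] := Sa _ (divr_gt0 e0 d0).
have -> : phi (a * b) - phi (b * a) = phi ((a - c) * b - b * (a - c)).
  by rewrite mulrBl mulrBr !linearB /= (Sb _ Sc); ring.
apply: (le_trans (state_bound _ _)); apply: (le_trans (cnormD _ _)).
rewrite cnormN; apply: (le_trans (lerD (cnormM _ _) (cnormM _ _))).
move: ac; rewrite ltr_pdivlMr // => /ltW; apply: le_trans.
by rewrite mulrDr mulr1 mulrnAr mulr2n [cnorm b * _]mulrC lerDl cnorm_ge0.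
Qed.

Lemma tracial_closure S : tracial_on phi S -> tracial_on phi (norm_closure S).
Proof.
move=> trS a b Sa Sb; apply: (commute_closure (S := S)) => // c Sc.
by apply/esym; apply: (commute_closure (S := S)) => // d Sd; exact: trS.
Qed.

(** Zorn's lemma is applied to *-subalgebras that need not be closed, since
    these are stable under unions of chains.  As the closure of a tracial
    *-subalgebra is tracial, a maximal one is closed. *)
Lemma maximal_tracial_extension S : star_subalg S -> tracial_on phi S ->
  exists2 M : csubalg A, maximal_tracial phi M & S `<=` M.
Proof.
move=> SS trS.
(* [S] is adjoined to every member, since the empty chain has union [set0]. *)
pose P (X : set A) := star_subalg (X `|` S) /\ tracial_on phi (X `|` S).
have P0 : P set0 by rewrite /P set0U.
have [F FP totF|X [[XS trX] Xmax]] := @Zorn_bigcup A P.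
  set U := \bigcup_(X in F) X.
  have sub X : F X -> X `|` S `<=` U `|` S.
    by move=> FX; apply: setSU => a Xa; exists X.
  have common a b : (U `|` S) a -> (U `|` S) b ->
      exists X, [/\ P X, X `|` S `<=` U `|` S, (X `|` S) a & (X `|` S) b].
    have S0 : set0 `|` S `<=` U `|` S by rewrite set0U; exact: subsetUr.
    move=> [[X FX Xa]|Sa] [[Y FY Yb]|Sb].
    - have [XY|YX] := totF _ _ FX FY.
        exists Y; split; [exact: FP|exact: sub|left; exact: XY|by left].
      exists X; split; [exact: FP|exact: sub|by left|left; exact: YX].
    - by exists X; split; [exact: FP|exact: sub|left|right].
    - by exists Y; split; [exact: FP|exact: sub|right|left].
    - by exists set0; split=> //; right.
  split; first split.
  - by right; exact: ssub1.
  - move=> a b Ua Ub; have [X [[XS _] XU Xa Xb]] := common _ _ Ua Ub.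
    exact: XU (ssubD XS Xa Xb).
  - move=> c a Ua; have [X [[XS _] XU Xa _]] := common _ _ Ua Ua.
    exact: XU (ssubZ XS c Xa).
  - move=> a b Ua Ub; have [X [[XS _] XU Xa Xb]] := common _ _ Ua Ub.
    exact: XU (ssubM XS Xa Xb).
  - move=> a Ua; have [X [[XS _] XU Xa _]] := common _ _ Ua Ua.
    exact: XU (ssub_star XS Xa).
  - move=> a b Ua Ub; have [X [[_ tr] _ Xa Xb]] := common _ _ Ua Ub.
    exact: tr.
exists (csubalg_closure XS); last first.
  by move=> a Sa; apply: sub_norm_closure; right.
split=> [|N trN XN]; first exact: tracial_closure.
have NS : N `|` S = N.
  by apply/setUidl => a Sa; apply: XN; apply: sub_norm_closure; right.
have XsubN : X `<=` N by move=> a Xa; apply: XN; apply: sub_norm_closure; left.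
have NX : N `<=` X.
  have PN : P N by split; rewrite NS //; exact: csubalg_star_subalg.
  by apply: contrapT => nNX; apply: (Xmax N).
by move=> a /NX Xa; apply: sub_norm_closure; left.
Qed.

End MaximalExtension.

(** * Finite orthonormal systems in the GNS space *)

Section Frames.
Variables (R : realType) (B : starAlgType R) (psi : state B).
Implicit Types (a v w y : B).
Local Notation C := R[i].

(** The position of the unit is part of the data because adjoining a vector
    shifts it. *)
Record frame := Frame {
  fdim : nat;
  fvec :> 'I_fdim.+1 -> B;
  funit : 'I_fdim.+1;
  fvec_unit : fvec funit = 1;
  fvec_orth : forall i j, psi (star (fvec i) * fvec j) = (i == j)%:R
}.
Implicit Type x : frame.

Definition fcomb x (c : 'I_(fdim x).+1 -> C) : B :=
  \sum_i c i *: x i.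

Definition fproj x v : B := fcomb (fun i => psi (star (x i) * v)).

Lemma fcomb_coord x (c : 'I_(fdim x).+1 -> C) i :
  psi (star (x i) * fcomb c) = c i.
Proof.
rewrite mulr_sumr linear_sum (bigD1 i) //= -scalerAr linearZ /=.
rewrite fvec_orth eqxx mulr1 big1 ?addr0 // => j ji.
by rewrite -scalerAr linearZ /= fvec_orth eq_sym (negbTE ji) mulr0.
Qed.

Lemma state_fcomb x (c : 'I_(fdim x).+1 -> C) v :
  psi (star (fcomb c) * v) = \sum_i conjc (c i) * psi (star (x i) * v).
Proof.
rewrite state_conj -[RHS]conjcK; congr conjc.
rewrite mulr_sumr linear_sum rmorph_sum; apply: eq_bigr => i _ /=.
by rewrite -scalerAr linearZ /= rmorphM /= conjcK -state_conj.
Qed.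

Lemma snorm_fcomb x (c : 'I_(fdim x).+1 -> C) :
  snorm psi (fcomb c) ^+ 2 = \sum_i cmod (c i) ^+ 2.
Proof.
apply: complexI; rewrite -snormE state_fcomb rmorph_sum.
by apply: eq_bigr => i _; rewrite fcomb_coord mulrC mulcJE.
Qed.

Lemma fproj_orth x v i : psi (star (x i) * (v - fproj x v)) = 0.
Proof. by rewrite mulrBr linearB /= fcomb_coord subrr. Qed.

Lemma snorm_pythagoras v w : psi (star v * w) = 0 ->
  snorm psi (v + w) ^+ 2 = snorm psi v ^+ 2 + snorm psi w ^+ 2.
Proof.
move=> vw; have wv : psi (star w * v) = 0 by rewrite state_conj vw rmorph0.
apply: complexI; rewrite rmorphD /= -!snormE.
by rewrite starD mulrDl !mulrDr !linearD /= vw wv addr0 add0r.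
Qed.

Lemma bessel x v :
  \sum_i cmod (psi (star (x i) * v)) ^+ 2 <= snorm psi v ^+ 2.
Proof.
rewrite -snorm_fcomb -/(fproj x v); set w := fproj x v.
have wr : psi (star w * (v - w)) = 0.
  by rewrite state_fcomb big1 // => i _; rewrite fproj_orth mulr0.
rewrite -[v in leRHS](subrK w) addrC (snorm_pythagoras wr).
by rewrite lerDl sqr_ge0.
Qed.

(** Vectors count modulo the null space of the seminorm. *)
Definition spans x v : Prop := snorm psi (v - fproj x v) = 0.

Fact trivial_frame_orth (i j : 'I_1) : psi (star 1 * 1) = (i == j)%:R.
Proof. by rewrite !ord1 eqxx star1 mulr1 state1. Qed.
Definition trivial_frame : frame :=
  @Frame 0 (fun _ => 1) ord0 erefl trivial_frame_orth.

Section Adjoin.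
Variables (x : frame) (y : B).
Hypothesis y_orth : forall i, psi (star (x i) * y) = 0.
Hypothesis y_unit : psi (star y * y) = 1.

Definition adjoin_vec (i : 'I_(fdim x).+2) : B :=
  if unlift ord0 i is Some j then x j else y.

Lemma adjoin_vec0 : adjoin_vec ord0 = y.
Proof. by rewrite /adjoin_vec unlift_none. Qed.

Lemma adjoin_vec_lift i : adjoin_vec (lift ord0 i) = x i.
Proof. by rewrite /adjoin_vec liftK. Qed.

Fact adjoin_unit : adjoin_vec (lift ord0 (funit x)) = 1.
Proof. by rewrite adjoin_vec_lift fvec_unit. Qed.

Fact adjoin_orth i j : psi (star (adjoin_vec i) * adjoin_vec j) = (i == j)%:R.
Proof.
case: (unliftP ord0 i) => [i'|] ->; case: (unliftP ord0 j) => [j'|] ->;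
  rewrite ?adjoin_vec0 ?adjoin_vec_lift ?y_orth ?eqxx //.
- by rewrite fvec_orth (inj_eq lift_inj).
- by rewrite (state_conj psi (x j')) y_orth rmorph0 (negbTE (neq_lift _ _)).
Qed.

Definition adjoin : frame := Frame adjoin_unit adjoin_orth.

Lemma fproj_adjoin v : fproj adjoin v = psi (star y * v) *: y + fproj x v.
Proof.
rewrite /fproj /fcomb big_ord_recl /= adjoin_vec0; congr (_ + _).
by apply: eq_bigr => i _; rewrite /= adjoin_vec_lift.
Qed.

Lemma adjoin_coord v : psi (star y * v) = psi (star y * (v - fproj x v)).
Proof.
rewrite mulrBr linearB /= (state_conj psi (fproj x v)) state_fcomb big1.
  by rewrite rmorph0 subr0.
by move=> i _; rewrite y_orth mulr0.
Qed.

Lemma spans_adjoin v : spans x v -> spans adjoin v.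
Proof.
rewrite /spans fproj_adjoin adjoin_coord => v0.
have -> : psi (star y * (v - fproj x v)) = 0.
  apply/ComplexField.Normc.eq0_normc/eqP; rewrite eq_le cmod_ge0 andbT.
  by have := snorm_CS psi y (v - fproj x v); rewrite v0 mulr0.
by rewrite scale0r add0r.
Qed.

End Adjoin.

(** Gram-Schmidt: the normalised component of [v] orthogonal to [x] is adjoined
    unless it vanishes. *)
Lemma extend_frame x v :
  exists2 x', (forall w, spans x w -> spans x' w) & spans x' v.
Proof.
set r := v - fproj x v; have [r0|r0] := eqVneq (snorm psi r) 0.
  by exists x.
set t := snorm psi r in r0; pose y := (t^-1)%:C *: r.
have y_orth i : psi (star (x i) * y) = 0.
  by rewrite -scalerAr linearZ /= fproj_orth mulr0.
have yr : psi (star y * r) = t%:C.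
  rewrite starZ conjc_real -scalerAl linearZ /= snormE -rmorphM /= -/t.
  by rewrite expr2 mulKf.
have y_unit : psi (star y * y) = 1.
  by rewrite {2}/y -scalerAr linearZ /= yr -rmorphM /= mulVf.
exists (adjoin y_orth y_unit) => [w|]; first exact: spans_adjoin.
rewrite /spans fproj_adjoin (adjoin_coord y_orth) -/r yr /y scalerA -rmorphM /= mulfV //.
by rewrite scale1r /r subrK subrr snorm0.
Qed.

Lemma spanning_frame (s : seq B) :
  exists x, forall v, v \in s -> spans x v.
Proof.
elim: s => [|w s [x xs]]; first by exists trivial_frame.
have [x' xx' x'w] := extend_frame x w; exists x' => v.
by rewrite in_cons => /orP[/eqP ->//|/xs/xx'].
Qed.

HB.instance Definition _ := gen_eqMixin frame.
HB.instance Definition _ := gen_choiceMixin frame.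
HB.instance Definition _ := isPointed.Build frame trivial_frame.

(** The second component of the index only serves to make the ultrafilter
    free: when the GNS space has finite dimension, a single frame spans it. *)
Lemma frame_ultrafilter : exists alpha : set_system (frame * nat)%type,
  [/\ UltraFilter alpha, nonprincipal alpha &
      forall v, alpha [set i | spans i.1 v]].
Proof.
pose base (s : seq B * nat) : set (frame * nat) :=
  [set i | (forall v, v \in s.1 -> spans i.1 v) /\ (s.2 <= i.2)%N].
have FF : ProperFilter (filter_from setT base).
  apply: filter_from_proper => [|[s m] _].
    apply: filter_fromT_filter; first by exists ([::], 0%N).
    move=> [s m] [s' m']; exists (s ++ s', maxn m m') => -[x k] /= [xs].
    rewrite geq_max => /andP[mk m'k].
    by split; split=> // v vs; apply: xs; rewrite mem_cat vs ?orbT.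
  by have [x xs] := spanning_frame s; exists (x, m).
have [alpha [ua sub]] := ultraFilterLemma FF.
exists alpha; split=> // [[x k] ax|v].
  have : alpha (base ([::], k.+1)) by apply: sub; exists ([::], k.+1).
  by rewrite ax => /principal_filterP[_]; rewrite /= ltnn.
apply: sub; exists ([:: v], 0%N) => // i [iv _].
by apply: iv; rewrite inE.
Qed.

Lemma infinite_frames : infinite_set [set: frame * nat].
Proof.
move=> /(finite_image snd); apply/infiniteP; apply: subset_card_le => n _.
by exists (trivial_frame, n).
Qed.

(** The compression of left multiplication by [a] to the span of [x]. *)
Definition compress x a : 'M[C]_((fdim x).+1) :=
  \matrix_(i, j) psi (star (x i) * (a * x j)).

(** Every column is the coordinate vector of [v]; [colnorm] only sees the first
    one. *)
Definition coords x v : 'M[C]_((fdim x).+1) :=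
  \matrix_(i, j) psi (star (x i) * v).

Lemma coordsD x v w : coords x (v + w) = coords x v + coords x w.
Proof. by apply/matrixP => i j; rewrite !mxE mulrDr linearD. Qed.

Lemma coordsZ x (c : C) v : coords x (c *: v) = c *: coords x v.
Proof. by apply/matrixP => i j; rewrite !mxE -scalerAr linearZ. Qed.

Lemma colnorm_coords x v : colnorm (coords x v) <= snorm psi v.
Proof.
rewrite -ler_sqr ?nnegrE ?snorm_ge0 // colnorm_sqr.
by under eq_bigr do rewrite mxE; exact: bessel.
Qed.

Lemma compressD x a b : compress x (a + b) = compress x a + compress x b.
Proof. by apply/matrixP => i j; rewrite !mxE mulrDl mulrDr linearD. Qed.

Lemma compressZ x (c : C) a : compress x (c *: a) = c *: compress x a.
Proof. by apply/matrixP => i j; rewrite !mxE -scalerAl -scalerAr linearZ. Qed.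

Lemma compress1 x : compress x 1 = 1.
Proof. by apply/matrixP => i j; rewrite !mxE mul1r fvec_orth. Qed.

Lemma compress_star x a : compress x (star a) = star (compress x a).
Proof.
by apply/matrixP => i j; rewrite !mxE -state_conj starM -mulrA.
Qed.

Lemma compress_mul x a X i :
  (compress x a * X) i ord0 =
  psi (star (x i) * (a * fcomb (fun k => X k ord0))).
Proof.
rewrite mxE !mulr_sumr linear_sum; apply: eq_bigr => k _ /=.
by rewrite mxE -!scalerAr linearZ mulrC.
Qed.

Lemma colnorm_compress x K a X : left_bound psi K a ->
  colnorm (compress x a * X) <= K * colnorm X.
Proof.
move=> [K0 Ka]; set w := fcomb (fun k => X k ord0).
have -> : colnorm (compress x a * X) = colnorm (coords x (a * w)).
  apply/eqP; rewrite -(@eqrXn2 _ 2) ?snorm_ge0 // !colnorm_sqr; apply/eqP.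
  by apply: eq_bigr => i _; rewrite compress_mul mxE.
apply: (le_trans (colnorm_coords _ _)); apply: (le_trans (Ka w)).
rewrite ler_wpM2l // -ler_sqr ?nnegrE ?snorm_ge0 //.
by rewrite snorm_fcomb colnorm_sqr.
Qed.

(** Once [v] is in the span, applying [a] and then projecting is what the
    compression does, with no error. *)
Lemma compress_coords x K a v : left_bound psi K a -> spans x v ->
  compress x a * coords x v = coords x (a * v).
Proof.
move=> [K0 Ka] xv; apply/eqP; rewrite eq_sym -subr_eq0; apply/eqP/matrixP.
move=> i j; rewrite !mxE.
have -> : \sum_k compress x a i k * coords x v k j =
    psi (star (x i) * (a * fproj x v)).
  rewrite !mulr_sumr linear_sum; apply: eq_bigr => k _ /=.
  by rewrite !mxE -!scalerAr linearZ mulrC.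
rewrite -linearB /= -!mulrBr; apply/ComplexField.Normc.eq0_normc/eqP.
rewrite eq_le cmod_ge0 andbT; apply: (le_trans (snorm_CS _ _ _)).
have := Ka (v - fproj x v); rewrite [snorm _ (v - _)]xv mulr0 => h.
by rewrite mulr_ge0_le0 ?snorm_ge0.
Qed.

End Frames.

(** * Strong limits of compressions *)

Section Embedding.
Variables (R : realType) (B : starAlgType R) (psi : tracial_state B).
Hypothesis bounded : forall a, exists K, left_bound psi K a.
Local Notation C := R[i].
Local Notation index := (frame psi * nat)%type.
Variable alpha : set_system index.
Hypothesis ualpha : UltraFilter alpha.
Hypothesis alpha_spans : forall v, alpha [set i | spans i.1 v].

Definition frame_mx (i : index) : cstarType R := 'M[C]_((fdim i.1).+1).
Definition frame_state (i : index) : state (frame_mx i) :=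
  mxstate R (funit i.1).

Local Notation prod := (cprod frame_mx).
Implicit Types (a v : B) (b : prod).
Local Notation phi := (ulim_state ualpha frame_state).

(** Strong convergence to left multiplication by [a], tested on the coordinates
    of the vectors of the GNS space. *)
Definition strong_lim b a : Prop := forall v (e : R), 0 < e ->
  \forall i \near alpha,
    colnorm ((b i : 'M[C]_((fdim i.1).+1)) * coords i.1 v - coords i.1 (a * v)) < e.

Lemma strong_limD b b' a a' :
  strong_lim b a -> strong_lim b' a' -> strong_lim (b + b') (a + a').
Proof.
move=> ba ba' v e e0; have e2 : 0 < e / 2%:R by rewrite divr_gt0.
apply: filterS2 (ba v _ e2) (ba' v _ e2) => i h h'.
rewrite !mulrDl coordsD opprD addrACA (splitr e).
exact: le_lt_trans (snormD _ _ _) (ltrD h h').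
Qed.

Lemma strong_limZ (c : C) b a : strong_lim b a -> strong_lim (c *: b) (c *: a).
Proof.
move=> ba v e e0; have c1 : 0 < cmod c + 1 by rewrite ltr_wpDl ?cmod_ge0.
apply: filterS (ba v _ (divr_gt0 e0 c1)) => i.
rewrite ltr_pdivlMr // -!scalerAl coordsZ -scalerBr /colnorm snormZ.
by apply: le_lt_trans; rewrite mulrDr mulr1 mulrC lerDl; exact: snorm_ge0.
Qed.

(** As for operators, boundedness of the left factor makes the product
    jointly strongly continuous:
    [b b' v - a a' v = b (b' v - a' v) + (b (a' v) - a (a' v))]. *)
Lemma strong_limM b b' a a' :
  strong_lim b a -> strong_lim b' a' -> strong_lim (b * b') (a * a').
Proof.
move=> ba ba' v e e0; have e2 : 0 < e / 2%:R by rewrite divr_gt0.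
have b1 : 0 < cnorm b + 1 by rewrite ltr_wpDl ?cnorm_ge0.
apply: filterS2 (ba (a' * v) _ e2) (ba' v _ (divr_gt0 e2 b1)) => i h h'.
set bi : 'M[C]_((fdim i.1).+1) := b i in h *.
set bi' : 'M[C]_((fdim i.1).+1) := b' i in h' *.
have -> : (b * b') i = bi * bi' by [].
have -> : bi * bi' * coords i.1 v - coords i.1 (a * a' * v) =
    bi * (bi' * coords i.1 v - coords i.1 (a' * v)) +
    (bi * coords i.1 (a' * v) - coords i.1 (a * (a' * v))).
  by rewrite mulrBr !mulrA addrA subrK.
rewrite (splitr e); apply: le_lt_trans (snormD _ _ _) _; apply: ltrD => //.
apply: le_lt_trans (colnorm_mul_le _ _) _.
move: h'; rewrite ltr_pdivlMr //; apply: le_lt_trans.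
rewrite mulrC ler_wpM2l ?snorm_ge0 // ler_wpDr //.
exact: (cprod_norm_ub b i).
Qed.

Lemma mul_coords1 (x : frame psi) (X : 'M[C]_((fdim x).+1)) i :
  (X * coords x 1) i ord0 = X i (funit x).
Proof.
have E k : coords x 1 k ord0 = (k == funit x)%:R.
  by rewrite mxE -fvec_orth fvec_unit.
rewrite mxE (bigD1 (funit x)) //= E eqxx mulr1 big1 ?addr0 // => k /negbTE kx.
by rewrite E kx mulr0.
Qed.

(** The state at index [i] is the vector state of the coordinates of [1], so in
    the limit it is [<1, a 1>]. *)
Lemma strong_lim_state b a : strong_lim b a -> phi b = psi a.
Proof.
move=> ba; apply: ulimE; apply/cvgcP => e e0.
apply: filterS (ba 1 _ e0) => i; apply: le_lt_trans.
set bi : 'M[C]_((fdim i.1).+1) := b i.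
apply: le_trans (entry_le_colnorm _ (funit i.1)).
rewrite -[X in X <= _]normcN opprB.
have -> : (bi * coords i.1 1 - coords i.1 (a * 1)) (funit i.1) ord0 =
    bi (funit i.1) (funit i.1) - psi a.
  by rewrite mxE mul_coords1 !mxE fvec_unit star1 mul1r mulr1.
by [].
Qed.

Fact compress_family_bounded a :
  exists K : R, forall i : index, cnorm (compress i.1 a : frame_mx i) <= K.
Proof.
have [K [K0 Ka]] := bounded a; exists K => i.
by apply: cnorm_mx_le => // X; exact: colnorm_compress.
Qed.

Definition compress_family a : prod := CProd (compress_family_bounded a).

Lemma compress_familyD a a' :
  compress_family (a + a') = compress_family a + compress_family a'.
Proof. by apply: cprodP => i; exact: compressD. Qed.

Lemma compress_familyZ (c : C) a :
  compress_family (c *: a) = c *: compress_family a.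
Proof. by apply: cprodP => i; exact: compressZ. Qed.

Lemma compress_family1 : compress_family 1 = 1.
Proof. by apply: cprodP => i; exact: compress1. Qed.

Lemma compress_family_star a :
  compress_family (star a) = star (compress_family a).
Proof. by apply: cprodP => i; exact: compress_star. Qed.

Lemma compress_family_lim a : strong_lim (compress_family a) a.
Proof.
move=> v e e0; apply: filterS (alpha_spans v) => i iv.
have [K Ka] := bounded a.
by rewrite /= (compress_coords Ka iv) subrr /colnorm snorm0.
Qed.

(** Taking adjoints is not strongly continuous, hence the second condition. *)
Definition star_strong_lim b a : Prop :=
  strong_lim b a /\ strong_lim (star b) (star a).

Lemma compress_family_star_lim a : star_strong_lim (compress_family a) a.
Proof.
by split; rewrite -?compress_family_star; exact: compress_family_lim.
Qed.

Lemma star_strong_limD b b' a a' : star_strong_lim b a ->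
  star_strong_lim b' a' -> star_strong_lim (b + b') (a + a').
Proof. by move=> [h k] [h' k']; split; rewrite ?starD; exact: strong_limD. Qed.

Lemma star_strong_limZ (c : C) b a :
  star_strong_lim b a -> star_strong_lim (c *: b) (c *: a).
Proof. by move=> [h k]; split; rewrite ?starZ; exact: strong_limZ. Qed.

Lemma star_strong_limM b b' a a' : star_strong_lim b a ->
  star_strong_lim b' a' -> star_strong_lim (b * b') (a * a').
Proof. by move=> [h k] [h' k']; split; rewrite ?starM; exact: strong_limM. Qed.

Definition strongly_convergent : set prod :=
  [set b | exists a, star_strong_lim b a].

Lemma strongly_convergent_subalg : star_subalg strongly_convergent.
Proof.
split.
- by exists 1; rewrite -compress_family1; exact: compress_family_star_lim.
- by move=> b b' [a ba] [a' ba']; exists (a + a'); exact: star_strong_limD.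
- by move=> c b [a ba]; exists (c *: a); exact: star_strong_limZ.
- by move=> b b' [a ba] [a' ba']; exists (a * a'); exact: star_strong_limM.
- by move=> b [a [h k]]; exists (star a); split; rewrite ?starK.
Qed.

Lemma strongly_convergent_tracial : tracial_on phi strongly_convergent.
Proof.
move=> b b' [a [ba _]] [a' [ba' _]].
rewrite (strong_lim_state (strong_limM ba ba')).
by rewrite (strong_lim_state (strong_limM ba' ba)) ts_tracial.
Qed.

Lemma strong_lim0_null b : star_strong_lim b 0 -> phi (star b * b) = 0.
Proof.
move=> [h k]; rewrite (strong_lim_state (strong_limM k h)).
by rewrite mulr0 linear0.
Qed.

(** Only multiplicativity needs the quotient: the compression of [a a'] minus
    the product of those of [a] and [a'] converges strongly to 0, together with
    its adjoint, hence is null. *)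
Lemma tracial_embedding :
  exists (M : csubalg prod) (maxM : maximal_tracial phi M)
         (pi : B -> maximal_tracial_quot maxM),
    [/\ pi 1 = 1, forall a a', pi (a + a') = pi a + pi a',
        forall (c : C) a, pi (c *: a) = c *: pi a,
        forall a a', pi (a * a') = pi a * pi a' &
        forall a, pi (star a) = star (pi a)] /\
    forall a, psi a = maximal_tracial_quot_state maxM (pi a).
Proof.
have [M maxM subM] := maximal_tracial_extension
  strongly_convergent_subalg strongly_convergent_tracial.
have inM a : compress_family a \in csub_pred M.
  by apply/asboolP/subM; exists a; exact: compress_family_star_lim.
pose fam a : csub_type M := CSubType (inM a).
pose pi a : maximal_tracial_quot maxM :=
  (\pi_(tracial_quot (csub_tracial_state maxM)) (fam a))%qT.
exists M, maxM, pi; split; last first.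
  move=> a; apply/esym; rewrite [LHS]tquot_state_funE.
  exact: strong_lim_state (compress_family_lim a).
split.
- by congr (\pi_ _ _)%qT; apply: val_inj; exact: compress_family1.
- move=> a a'; rewrite -[RHS]tquotD; congr (\pi_ _ _)%qT.
  by apply: val_inj; exact: compress_familyD.
- move=> c a; rewrite -[RHS]tquotZ; congr (\pi_ _ _)%qT.
  by apply: val_inj; exact: compress_familyZ.
- move=> a a'; rewrite -[RHS]tquotM; apply: tquot_eq.
  apply: strong_lim0_null => /=.
  have -> : 0 = a * a' + (-1) *: (a * a') by rewrite scaleN1r subrr.
  rewrite -[- _]scaleN1r; apply: star_strong_limD.
    exact: compress_family_star_lim.
  apply: star_strong_limZ; apply: star_strong_limM;
    exact: compress_family_star_lim.
- move=> a; rewrite [RHS]tquot_star_cls; congr (\pi_ _ _)%qT.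
  by apply: val_inj; exact: compress_family_star.
Qed.

End Embedding.

(** * A von Neumann algebra as a *-algebra *)

Section Adjoints.
Variables (R : realType) (H : hilbertType R).
Implicit Types (x y z : H) (S T : H -> H).

Lemma inner0l y : inner (0 : H) y = 0.
Proof. by rewrite -(scale0r (0 : H)) innerZl mul0r. Qed.

Lemma innerBl x y z : inner (x - y) z = inner x z - inner y z.
Proof. by rewrite innerDl -scaleN1r innerZl mulN1r. Qed.

Lemma innerDr x y z : inner z (x + y) = inner z x + inner z y.
Proof.
by rewrite inner_conj innerDl rmorphD /= -!inner_conj.
Qed.

Lemma innerZr (c : R[i]) x z : inner z (c *: x) = conjc c * inner z x.
Proof. by rewrite inner_conj innerZl rmorphM /= -inner_conj. Qed.

Lemma inner_eq0 z : inner z z = 0 -> z = 0.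
Proof.
by rewrite inner_norm => /eqP; rewrite sqrf_eq0 normr_eq0 => /eqP.
Qed.

Lemma adjoint_unique T S S' : is_adjoint T S -> is_adjoint T S' -> S = S'.
Proof.
move=> TS TS'; apply/funext => y; apply/eqP; rewrite -subr_eq0; apply/eqP.
apply: inner_eq0; rewrite -[S' y]scale1r -scaleNr innerDr innerZr.
by rewrite -TS -TS' rmorphN rmorph1 mulN1r subrr.
Qed.

Lemma adjoint_sym T S : is_adjoint T S -> is_adjoint S T.
Proof. by move=> TS x y; rewrite inner_conj -TS -inner_conj. Qed.

Lemma adjointD T S T' S' :
  is_adjoint T S -> is_adjoint T' S' -> is_adjoint (T \+ T') (S \+ S').
Proof. by move=> h h' x y; rewrite /= innerDl innerDr h h'. Qed.

Lemma adjointZ (c : R[i]) T S :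
  is_adjoint T S -> is_adjoint (c \*: T) (conjc c \*: S).
Proof. by move=> h x y; rewrite /= innerZl innerZr conjcK h. Qed.

Lemma adjointM T S T' S' :
  is_adjoint T S -> is_adjoint T' S' -> is_adjoint (T \o T') (S' \o S).
Proof. by move=> h h' x y; rewrite /= h h'. Qed.

End Adjoints.

Section OperatorAlgebra.
Variables (R : realType) (H : hilbertType R).
Variables (V : set (H -> H)) (tau : (H -> H) -> R[i]).

Record vn_op := VnOp { op :> H -> H; op_in : V op }.

(** The two proofs are parameters of the type so that the algebraic structures
    can be attached to it; the second one gives [1 != 0], as it excludes
    [H = 0]. *)
Definition vn_algebra of von_neumann V & operator_state V tau := vn_op.

Variables (vnV : von_neumann V) (st : operator_state V tau).
Local Notation B := (vn_algebra vnV st).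
Implicit Types (a b c : B) (S T : H -> H).

Lemma vn_opP a b : (forall x, a x = b x) -> a = b.
Proof.
case: a b => [S VS] [T VT] /= ST; have {}ST : S = T by apply/funext.
by move: VS VT; rewrite ST => VS VT; congr VnOp; exact: Prop_irrelevance.
Qed.

HB.instance Definition _ := gen_eqMixin B.
HB.instance Definition _ := gen_choiceMixin B.

Definition vn_add a b : B := VnOp (vnD vnV (op_in a) (op_in b)).
Definition vn_scale (c : R[i]) a : B := VnOp (vnZ vnV c (op_in a)).
Definition vn_one : B := VnOp (vn1 vnV).
Definition vn_zero : B := vn_scale 0 vn_one.
Definition vn_opp a : B := vn_scale (-1) a.
Definition vn_mul a b : B := VnOp (vnM vnV (op_in a) (op_in b)).

Lemma vn_linear a : linear a.
Proof. by have [] := vn_bounded vnV (op_in a). Qed.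

Lemma vn_opD a x y : a (x + y) = a x + a y.
Proof. by have := vn_linear a 1 x y; rewrite !scale1r. Qed.

Lemma vn_op0 a : a 0 = 0.
Proof. by apply: (addrI (a 0)); rewrite -vn_opD !addr0. Qed.

Lemma vn_opZ a (d : R[i]) x : a (d *: x) = d *: a x.
Proof. by have := vn_linear a d x 0; rewrite !addr0 vn_op0 addr0. Qed.

Fact vn_addA : associative vn_add.
Proof. by move=> a b c; apply: vn_opP => x /=; rewrite addrA. Qed.
Fact vn_addC : commutative vn_add.
Proof. by move=> a b; apply: vn_opP => x /=; rewrite addrC. Qed.
Fact vn_add0 : left_id vn_zero vn_add.
Proof. by move=> a; apply: vn_opP => x /=; rewrite scale0r add0r. Qed.
Fact vn_addN : left_inverse vn_zero vn_opp vn_add.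
Proof.
by move=> a; apply: vn_opP => x /=; rewrite scaleN1r scale0r addNr.
Qed.
HB.instance Definition _ :=
  GRing.isZmodule.Build B vn_addA vn_addC vn_add0 vn_addN.

Fact vn_mulA : associative vn_mul.
Proof. by move=> a b c; apply: vn_opP. Qed.
Fact vn_mul1l : left_id vn_one vn_mul.
Proof. by move=> a; apply: vn_opP. Qed.
Fact vn_mul1r : right_id vn_one vn_mul.
Proof. by move=> a; apply: vn_opP. Qed.
Fact vn_mulDl : left_distributive vn_mul +%R.
Proof. by move=> a b c; apply: vn_opP. Qed.
Fact vn_mulDr : right_distributive vn_mul +%R.
Proof. by move=> a b c; apply: vn_opP => x /=; rewrite vn_opD. Qed.
Fact vn_one_neq0 : vn_one != 0.
Proof.
apply/eqP => /(congr1 (fun a : B => tau a)).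
rewrite /= (op_state1 st) (op_stateZ st) ?mul0r; last exact: vn1 vnV.
exact/eqP/oner_neq0.
Qed.
HB.instance Definition _ := GRing.Zmodule_isNzRing.Build B
  vn_mulA vn_mul1l vn_mul1r vn_mulDl vn_mulDr vn_one_neq0.

Fact vn_scaleA (d e : R[i]) a :
  vn_scale d (vn_scale e a) = vn_scale (d * e) a.
Proof. by apply: vn_opP => x /=; rewrite scalerA. Qed.
Fact vn_scale1 : left_id 1 vn_scale.
Proof. by move=> a; apply: vn_opP => x /=; rewrite scale1r. Qed.
Fact vn_scaleDr : right_distributive vn_scale +%R.
Proof. by move=> d a b; apply: vn_opP => x /=; rewrite scalerDr. Qed.
Fact vn_scaleDl a : {morph vn_scale^~ a : d e / d + e}.
Proof. by move=> d e; apply: vn_opP => x /=; rewrite scalerDl. Qed.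
HB.instance Definition _ := GRing.Zmodule_isLmodule.Build R[i] B
  vn_scaleA vn_scale1 vn_scaleDr vn_scaleDl.

Fact vn_scaleAl (d : R[i]) a b : d *: (a * b) = (d *: a) * b.
Proof. by apply: vn_opP. Qed.
HB.instance Definition _ := GRing.Lmodule_isLalgebra.Build R[i] B vn_scaleAl.
Fact vn_scaleAr (d : R[i]) a b : d *: (a * b) = a * (d *: b).
Proof. by apply: vn_opP => x /=; rewrite vn_opZ. Qed.
HB.instance Definition _ := GRing.Lalgebra_isAlgebra.Build R[i] B vn_scaleAr.

Definition vn_star a : B :=
  VnOp (s2valP (cid2 (vn_adjoint vnV (op_in a)))).

Lemma vn_starP a : is_adjoint a (vn_star a).
Proof. exact: s2valP' (cid2 (vn_adjoint vnV (op_in a))). Qed.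

Lemma vn_star_unique a b : is_adjoint a b -> vn_star a = b.
Proof.
by move=> ab; apply: vn_opP => x; rewrite (adjoint_unique (vn_starP a) ab).
Qed.

Fact vn_starK : involutive vn_star.
Proof. by move=> a; apply/vn_star_unique/adjoint_sym/vn_starP. Qed.
Fact vn_starD : {morph vn_star : a b / a + b}.
Proof.
by move=> a b; apply: vn_star_unique; apply: adjointD; exact: vn_starP.
Qed.
Fact vn_starZ (d : R[i]) a : vn_star (d *: a) = conjc d *: vn_star a.
Proof. by apply: vn_star_unique; apply: adjointZ; exact: vn_starP. Qed.
Fact vn_starM a b : vn_star (a * b) = vn_star b * vn_star a.
Proof. by apply: vn_star_unique; apply: adjointM; exact: vn_starP. Qed.
HB.instance Definition _ := Algebra_hasStar.Build R B
  vn_starK vn_starD vn_starZ vn_starM.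

Definition vn_state_fun a : R[i] := tau a.

Fact vn_state_scalar : scalar vn_state_fun.
Proof.
move=> d a b; rewrite /vn_state_fun (op_stateD st) ?(op_stateZ st) //; exact: op_in.
Qed.
HB.instance Definition _ :=
  GRing.isLinear.Build _ _ _ _ vn_state_fun vn_state_scalar.

Fact vn_state_ge0 a : 0 <= vn_state_fun (star a * a).
Proof. by apply: (op_state_ge0 st (op_in a)); exact: vn_starP. Qed.

Fact vn_state1 : vn_state_fun 1 = 1.
Proof. exact: op_state1 st. Qed.

Definition vn_state : state B :=
  @State R B vn_state_fun vn_state_ge0 vn_state1.

Hypothesis normal : operator_normal V tau.

(** The larger of two comparable operators is the supremum of the pair, which is
    upward directed, so normality makes its trace the larger of the two traces. *)
Lemma normal_monotone S T : V S -> V T -> self_adjoint S -> self_adjoint T ->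
  operator_le S T -> complex.Re (tau S) <= complex.Re (tau T).
Proof.
move=> VS VT sS sT ST.
have refl U : operator_le U U by move=> x; rewrite subrr inner0l.
have -> : complex.Re (tau T) =
    sup [set complex.Re (tau U) | U in [set S] `|` [set T]].
  apply: normal => //.
  - by exists S; left.
  - by move=> U [] ->.
  - by move=> U U' [] -> [] ->; exists T => //; try (by right); split.
  - by move=> U [] ->.
  - by move=> U _ _; apply; right.
apply: ub_le_sup; last by exists S => //; left.
exists (Order.max (complex.Re (tau S)) (complex.Re (tau T))).
by move=> _ [U [] -> <-]; rewrite le_max lexx ?orbT.
Qed.

(** [K^2 b^* b - b^* a^* a b] is a positive operator: at [x] its value is
    [K^2 ||b x||^2 - ||a b x||^2]. *)
Lemma vn_left_bounded a : exists K, left_bound vn_state K a.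
Proof.
have [_ [K aK]] := vn_bounded vnV (op_in a).
exists `|K|; split=> // b; rewrite -[`|K|]ger0_norm // -sqrtr_sqr.
rewrite /snorm -sqrtrM ?sqr_ge0 // ler_wsqrtr //.
set L := `|K| ^+ 2.
have -> : L * complex.Re (vn_state (star b * b)) =
    complex.Re (vn_state (L%:C *: (star b * b))).
  by rewrite linearZ snormE /= mul0r subr0.
have sa c : self_adjoint (star c * c : B).
  have := vn_starP (star c * c); rewrite -[vn_star _]/(star _).
  by rewrite starM starK.
pose P : B := star (a * b) * (a * b); pose Q : B := L%:C *: (star b * b).
apply: (@normal_monotone P Q); first exact: op_in.
- exact: op_in.
- exact: sa.
- by have := adjointZ L%:C (sa b); rewrite conjc_real.
move=> x.
have E c : inner ((star c * c : B) x) x = `|c x| ^+ 2.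
  by rewrite -inner_norm; apply: (adjoint_sym (vn_starP c)).
rewrite innerBl [X in X - _]innerZl !E subr_ge0.
have -> : L%:C = `|K|%:C ^+ 2 by rewrite -rmorphXn.
rewrite -exprMn ler_sqr ?nnegrE ?normr_ge0 //.
  apply: le_trans (aK (b x)) _; apply: ler_wpM2r; first exact: normr_ge0.
  by rewrite lecR ler_norm.
by rewrite mulr_ge0 ?normr_ge0 // ler0c.
Qed.

Hypothesis tracial : operator_tracial V tau.

Fact vn_tracial a b : vn_state (a * b) = vn_state (b * a).
Proof. by apply: tracial; exact: op_in. Qed.

Definition vn_tracial_state : tracial_state B := TracialState vn_tracial.

End OperatorAlgebra.

(** * The embedding of a von Neumann algebra *)

Theorem theorem5p1 (R : realType) (H : hilbertType R)
    (V : set (H -> H)) (tau : (H -> H) -> R[i]) :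
  separable H -> von_neumann V ->
  operator_state V tau -> operator_tracial V tau ->
  operator_faithful V tau -> operator_normal V tau ->
  exists (I : pointedType) (alpha : set_system I)
      (ualpha : UltraFilter alpha)
      (A : I -> cstarType R) (phi : forall i, state (A i)),
    [/\ infinite_set [set: I],
        nonprincipal alpha,
        forall i, finite_dimensional (A i)
      & exists (M : csubalg (cprod A))
               (maxM : maximal_tracial (ulim_state ualpha phi) M)
               (pi : (H -> H) -> maximal_tracial_quot maxM),
          operator_star_morphism V pi /\
          forall T, V T -> tau T = maximal_tracial_quot_state maxM (pi T)].
Proof.
move=> _ vnV st tr _ normal.
pose psi := vn_tracial_state vnV st tr.
have [alpha [ualpha free spans]] := frame_ultrafilter psi.
have [M [maxM [pi [[pi1 piD piZ piM pi_star] tauE]]]] :=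
  tracial_embedding (psi := psi) (vn_left_bounded normal) ualpha spans.
exists (frame psi * nat)%type, alpha, ualpha, (@frame_mx _ _ psi),
  (@frame_state _ _ psi); split=> //.
- exact: infinite_frames.
- by move=> i; exact: mx_finite_dimensional.
pose rho T := if pselect (V T) is left VT then pi (VnOp VT) else 0.
have rhoE (a : vn_algebra vnV st) : rho a = pi a.
  rewrite /rho; case: pselect => [VT|/(_ (op_in a))//].
  by congr pi; exact: vn_opP.
exists M, maxM, rho; split=> [|T VT]; last first.
  by rewrite (rhoE (VnOp VT)) -tauE.
split=> [|S T VS VT|c T VT|S T VS VT|T S VT TS].
- by rewrite -pi1 -rhoE.
- by rewrite (rhoE (VnOp VS)) (rhoE (VnOp VT)) -piD -rhoE.
- by rewrite (rhoE (VnOp VT)) -piZ -rhoE.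
- by rewrite (rhoE (VnOp VS)) (rhoE (VnOp VT)) -piM -rhoE.
rewrite (rhoE (VnOp VT)) -pi_star -rhoE; congr rho.
exact: adjoint_unique TS (vn_starP (VnOp VT)).
Qed.
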